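(* Let $F$ be a Banach space of cotype $q$, let $X$ be an $\mathcal{L}_{\infty,\lambda}$ space for some $\lambda>1$, and let $f:X\to F$ be a mapping which is analytic at a point $a\in X$. Then $f$ is absolutely $(q;2)$-summing at $a$.
   Context: All spaces are Banach spaces over $\mathbb{K}=\mathbb{R}$ or $\mathbb{C}$. $X$ is an $\mathcal{L}_{\infty,\lambda}$ space ($\lambda>1$) if every finite dimensional subspace $G$ of $X$ is contained in a finite dimensional subspace $H$ of $X$ for which there is an isomorphism $v:H\to l_\infty^{\dim H}$ with $\|v\|\|v^{-1}\|<\lambda$. For $2\le q\le\infty$, $F$ has cotype $q$ if there is a constant $C_q(F)\ge0$ such that $(\sum_{j=1}^k\|x_j\|^q)^{1/q}\le C_q(F)\big(\int_0^1\|\sum_{j=1}^k r_j(t)x_j\|^2dt\big)^{1/2}$ for all $k$ and $x_1,\dots,x_k\in F$ ($r_j$ the Rademacher functions; the left side is $\max_j\|x_j\|$ if $q=\infty$). $f:E\to F$ is analytic at $a\in E$ if there are a ball $B_\delta(a)$ and continuous $k$-homogeneous polynomials $P_k:E\to F$ such that $f(x)=\sum_{k=0}^\infty P_k(x-a)$ uniformly for $x\in B_\delta(a)$. For $0<p<\infty$, $\|(x_j)\|_{w,p}=\sup_{\varphi\in B_{E'}}(\sum_j|\varphi(x_j)|^p)^{1/p}$, $l_p^w(E)$ is the space of sequences in $E$ for which this is finite, and $l_p^u(E)$ is the subspace of those $(x_j)\in l_p^w(E)$ with $\lim_{m\to\infty}\|(x_j)_{j=m}^\infty\|_{w,p}=0$.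 $l_p(E)$ is the space of sequences with $\sum_j\|x_j\|^p<\infty$ (bounded sequences if $p=\infty$). A mapping $f:E\to F$ is absolutely $(s;r)$-summing at $a\in E$ if $(f(a+x_j)-f(a))_{j=1}^\infty\in l_s(F)$ whenever $(x_j)_{j=1}^\infty\in l_r^u(E)$. *)

(* Defs.v *)
From HB Require Import structures.
From mathcomp Require Import all_boot all_order all_algebra.
From mathcomp Require Import complex.
From mathcomp Require Import all_classical all_reals all_analysis.

Set Implicit Arguments.
Unset Strict Implicit.
Unset Printing Implicit Defensive.

Import Order.TTheory GRing.Theory Num.Theory.
Import numFieldNormedType.Exports.

Local Open Scope classical_set_scope.
Local Open Scope ring_scope.

Variant scalar_kind := RealScalars | ComplexScalars.

Definition scalar_field (R : realType) (s : scalar_kind) : numFieldType :=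
  match s with
  | RealScalars => (R : numFieldType)
  | ComplexScalars => (R[i] : numFieldType)
  end.

Definition scalar_re (R : realType) (s : scalar_kind) : scalar_field R s -> R :=
  match s with
  | RealScalars => fun x => x
  | ComplexScalars => fun x => complex.Re x
  end.

(* The library's norm on a normed module over K takes its values in K. Those
   values are nonnegative reals, so nothing is lost by taking the real part. *)
Definition rnorm (R : realType) (s : scalar_kind)
    (E : normedModType (scalar_field R s)) (x : E) : R :=
  scalar_re `|x|.

Definition subspace_of_dim (K : numFieldType) (E : lmodType K) (n : nat)
    (G : set E) : Prop :=
  exists2 b : 'I_n -> E,
    (forall c : 'I_n -> K, \sum_(i < n) c i *: b i = 0 -> forall i, c i = 0) &
    G = [set x | exists c : 'I_n -> K, x = \sum_(i < n) c i *: b i].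

Definition opnorm (R : realType) (s : scalar_kind)
    (E F : normedModType (scalar_field R s)) (D : set E) (v : E -> F)
    : \bar R :=
  ereal_sup [set (rnorm (v x))%:E | x in D `&` [set x | rnorm x <= 1]].

(* l_oo^n is 'rV_n, whose norm is the maximum of the absolute values of the
   entries. The isomorphism v is only constrained on H, and w is its inverse. *)
Definition Linfty_space (R : realType) (s : scalar_kind)
    (X : normedModType (scalar_field R s)) (lambda : R) : Prop :=
  forall (m : nat) (G : set X), subspace_of_dim m G ->
  exists (n : nat) (H : set X),
    [/\ subspace_of_dim n H, G `<=` H &
      exists (v : X -> 'rV[scalar_field R s]_n)
             (w : 'rV[scalar_field R s]_n -> X),
        [/\ (forall (c : scalar_field R s) (x y : X), H x -> H y ->
               v (c *: x + y) = c *: v x + v y),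
            (forall x, H x -> w (v x) = x),
            (forall y, H (w y)),
            (forall y, v (w y) = y) &
            (opnorm H v * opnorm [set: 'rV_n] w < lambda%:E)%E]].

Definition rademacher (R : realType) (j : nat) (t : R) : int :=
  sgz (sin (2 ^+ j * pi * t)).

(* The j-th vector, j = 0, ..., k - 1, is paired with the Rademacher function
   of index j + 1, so that the first one is sign (sin (2 pi t)). *)
Definition rademacher_average (R : realType) (s : scalar_kind)
    (F : normedModType (scalar_field R s)) (k : nat) (x : 'I_k -> F) : R :=
  Num.sqrt (\int[@lebesgue_measure R]_(t in `[0%R, 1%R])
    (rnorm (\sum_(j < k) x j *~ rademacher j.+1 t) ^+ 2)).

(* Only meant for 0 < q. *)
Definition lq_norm (R : realType) (s : scalar_kind)
    (F : normedModType (scalar_field R s)) (q : \bar R) (k : nat)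
    (x : 'I_k -> F) : R :=
  if q is r%:E%E then (\sum_(j < k) rnorm (x j) `^ r) `^ r^-1
  else \big[Num.max/0]_(j < k) rnorm (x j).

Definition has_cotype (R : realType) (s : scalar_kind)
    (F : normedModType (scalar_field R s)) (q : \bar R) : Prop :=
  exists2 C : R, 0 <= C &
    forall (k : nat) (x : 'I_k -> F), lq_norm q x <= C * rademacher_average x.

Definition multilinear (K : numFieldType) (E F : lmodType K) (k : nat)
    (A : ('I_k -> E) -> F) : Prop :=
  forall (x : 'I_k -> E) (i : 'I_k),
    linear (fun u : E => A (fun j => if j == i then u else x j)).

Definition homogeneous_polynomial (K : numFieldType) (E F : lmodType K)
    (k : nat) (P : E -> F) : Prop :=
  exists2 A : ('I_k -> E) -> F, multilinear A & forall x, P x = A (fun=> x).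

Definition analytic_at (R : realType) (s : scalar_kind)
    (E F : normedModType (scalar_field R s)) (f : E -> F) (a : E) : Prop :=
  exists (delta : scalar_field R s) (P : nat -> E -> F),
    [/\ 0 < delta,
        (forall k, homogeneous_polynomial k (P k) /\ continuous (P k)) &
        {uniform ball a delta,
          (fun (n : nat) (x : E) => \sum_(0 <= k < n) P k (x - a)) @ \oo
            --> f}].

Definition weak_norm (R : realType) (s : scalar_kind)
    (E : normedModType (scalar_field R s)) (p : R) (x : nat -> E) : \bar R :=
  ereal_sup
    [set ((\sum_(0 <= j <oo) (rnorm (phi (x j)) `^ p)%:E) `^ p^-1)%E
    | phi in [set phi : {linear E -> (scalar_field R s)^o}
             | continuous phi /\ (opnorm [set: E] phi <= 1%:E)%E]].

Definition lw_seq (R : realType) (s : scalar_kind)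
    (E : normedModType (scalar_field R s)) (p : R) : set (nat -> E) :=
  [set x | (weak_norm p x < +oo)%E].

Definition lu_seq (R : realType) (s : scalar_kind)
    (E : normedModType (scalar_field R s)) (p : R) : set (nat -> E) :=
  [set x | lw_seq p x /\
    weak_norm p (fun j => x (m + j)%N) @[m --> \oo] --> 0%E].

(* Only meant for 0 < p. *)
Definition lp_seq (R : realType) (s : scalar_kind)
    (F : normedModType (scalar_field R s)) (p : \bar R) : set (nat -> F) :=
  [set y | if p is r%:E%E
           then (\sum_(0 <= j <oo) (rnorm (y j) `^ r)%:E < +oo)%E
           else exists M : R, forall j, rnorm (y j) <= M].

Definition absolutely_summing_at (R : realType) (s : scalar_kind)
    (E F : normedModType (scalar_field R s)) (p : \bar R) (r : R) (f : E -> F)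
    (a : E) : Prop :=
  forall x : nat -> E, lu_seq r x -> lp_seq p (fun j => f (a + x j) - f a).

(* Main.v *)
Require Import Defs.
From HB Require Import structures.
From mathcomp Require Import all_boot all_order all_algebra.
From mathcomp Require Import fingroup perm complex ring lra.
From mathcomp Require Import all_classical all_reals all_analysis.
From mathcomp Require Import measurable_realfun.
Set Implicit Arguments.
Unset Strict Implicit.
Unset Printing Implicit Defensive.
Import Order.TTheory GRing.Theory Num.Theory.
Import numFieldNormedType.Exports.
Local Open Scope ring_scope.

(** Only a tail of the sequence x matters, and its weak 2-norm is as small as
    one wishes. Finitely many vectors of the tail span a space contained in a
    subspace H close to some l_oo^d. By Hahn-Banach the coordinates of H extend
    to X without increase of norm, so the vectors become z_1, ..., z_J in
    l_oo^d with sum_j |z_j(i)|^2 <= 1 at every coordinate i, and a linear map w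
    sends the unit cube of l_oo^d into a small ball of X ([Linfty_factor]). It
    remains to estimate sum_j ||P_k (w z_j)||^q for each homogeneous term P_k,
    with a constant that grows at most exponentially in k.

    For k = 1 this is a theorem of Maurey on operators from l_oo^d into a space
    of cotype q. It is proved here for functions Phi (meant as ||u(.)||^q) that
    are convex, q-homogeneous, at most M on the cube, and satisfy the cotype
    inequality sum_j Phi (z_j) <= C E Phi (sum_j eps_j z_j): then
    sum_j Phi (z_j) <= kappa M, where kappa depends on q and C only
    ([linear_summing]). The best constant pi is finite because d is, and it is
    bounded by a + pi / 2 with a of the required form.
    - If q = 2, cut Y = sum_j eps_j z_j at a level L. The small part gives at
      most L^2 M; the large part has second moment at most 3 / L^2, because the
      fourth moment of Y is at most 3, so it gives at most 3 pi / L^2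
      ([summing_const_2]).
    - If q > 2, cut each z_j at the level 1 / L. The large parts are weakly
      1-summable, and for those the cotype inequality suffices. The small parts
      contribute at most a multiple of L^(2 - q) pi, by Pisier's perturbation of
      an almost extremal family ([pisier_bounded_family],
      [summing_const_gt2]).

    Sums of such functions Phi are again such functions, with the same C.
    Hence a k-linear map can be treated one slot at a time, which costs kappa^k
    ([multilinear_summing]). Polarization bounds the symmetric k-linear map of
    P_k on the cube by a multiple (4 ||w|| / rho)^k of the bound of P_k on the
    ball of radius rho ([polynomial_summing]). As all constants are exponential
    in k and ||w|| is small, the sum over k is dominated by a geometric series
    ([power_series_summing]). Finally the P_k are bounded on a common ball: for
    large k as differences of consecutive partial sums, which converge
    uniformly, and for the others by continuity ([analytic_at_series]). For
    q = oo the claim is that f (a + x_j) - f a is bounded, and it follows as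
    soon as the tail lies in that ball ([analytic_summing_infty]). *)

(** * Real and complex scalars *)

Definition emb (R : realType) (s : scalar_kind) : R -> scalar_field R s :=
  match s with
  | RealScalars => idfun
  | ComplexScalars => real_complex R
  end.

Section Scalars.
Variables (R : realType) (s : scalar_kind).
Notation K := (scalar_field R s).

Lemma emb_zmod : zmod_morphism (@emb R s).
Proof. by case: s => x y //=; rewrite rmorphB. Qed.

Lemma emb_monoid : monoid_morphism (@emb R s).
Proof. by case: s; split=> [|x y] //=; rewrite ?rmorph1 ?rmorphM. Qed.

HB.instance Definition _ := GRing.isZmodMorphism.Build R K (@emb R s) emb_zmod.
HB.instance Definition _ := GRing.isMonoidMorphism.Build R K (@emb R s) emb_monoid.

Lemma embD (x y : R) : emb s (x + y) = emb s x + emb s y.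
Proof. exact: rmorphD. Qed.

Lemma embN (x : R) : emb s (- x) = - emb s x.
Proof. exact: rmorphN. Qed.

Lemma embM (x y : R) : emb s (x * y) = emb s x * emb s y.
Proof. exact: rmorphM. Qed.

Lemma emb0 : emb s (0 : R) = 0.
Proof. exact: rmorph0. Qed.

Lemma emb1 : emb s (1 : R) = 1.
Proof. exact: rmorph1. Qed.

Lemma ler_emb : {mono @emb R s : x y / x <= y}.
Proof. by case: s => x y //=; rewrite lecR. Qed.

Lemma emb_scalar_re (z : K) : 0 <= z -> emb s (scalar_re z) = z.
Proof.
by case: s z => [z //|[a b]] /=; rewrite lecE /= => /andP[/eqP-> _].
Qed.

Lemma emb_ge0 (r : R) : (0 <= emb s r) = (0 <= r).
Proof. by rewrite -emb0 ler_emb. Qed.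

Lemma ltr_emb : {mono @emb R s : x y / x < y}.
Proof. by apply: leW_mono; apply: ler_emb. Qed.

Lemma norm_emb (r : R) : `|emb s r| = emb s `|r|.
Proof.
have [r0|r0] := leP 0 r; first by rewrite !ger0_norm ?emb_ge0.
rewrite (ltr0_norm r0) embN ler0_norm //.
by rewrite -emb0 ler_emb ltW.
Qed.

Lemma scalar_reK (r : R) : scalar_re (emb s r) = r.
Proof. by case: s. Qed.

Definition cabs (z : K) : R := scalar_re `|z|.

Lemma emb_cabs (z : K) : emb s (cabs z) = `|z|.
Proof. exact: emb_scalar_re. Qed.

Lemma cabs_ge0 (z : K) : 0 <= cabs z.
Proof. by rewrite -emb_ge0 emb_cabs. Qed.

Lemma emb_inj : injective (emb s : R -> K).
Proof. exact: fmorph_inj. Qed.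

Lemma cabsM (z w : K) : cabs (z * w) = cabs z * cabs w.
Proof. by apply: emb_inj; rewrite embM !emb_cabs normrM. Qed.

Lemma cabs_emb (r : R) : cabs (emb s r) = `|r|.
Proof. by apply: emb_inj; rewrite emb_cabs norm_emb. Qed.

Lemma cabsD (z w : K) : cabs (z + w) <= cabs z + cabs w.
Proof. by rewrite -ler_emb embD !emb_cabs ler_normD. Qed.

Lemma cabsN (z : K) : cabs (- z) = cabs z.
Proof. by rewrite /cabs normrN. Qed.

Lemma cabs0 : cabs 0 = 0.
Proof. by apply: emb_inj; rewrite emb_cabs normr0 emb0. Qed.

Lemma cabs_parallelogram (z w : K) :
  cabs (z + w) ^+ 2 + cabs (z - w) ^+ 2 = 2 * (cabs z ^+ 2 + cabs w ^+ 2).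
Proof.
rewrite /cabs; case: s z w => [z w|[a b] [c d]] /=.
  by rewrite !real_normK ?num_real //; ring.
by rewrite !sqr_sqrtr ?addr_ge0 ?sqr_ge0 //; ring.
Qed.

Section Norm.
Variable E : normedModType K.
Implicit Types x y : E.

Lemma emb_rnorm x : emb s (rnorm x) = `|x|.
Proof. exact: emb_scalar_re. Qed.

Lemma rnorm_ge0 x : 0 <= rnorm x.
Proof. by rewrite -emb_ge0 emb_rnorm. Qed.

Lemma rnormZ (c : K) x : rnorm (c *: x) = cabs c * rnorm x.
Proof. by apply: emb_inj; rewrite embM emb_cabs !emb_rnorm normrZ. Qed.

Lemma rnormD x y : rnorm (x + y) <= rnorm x + rnorm y.
Proof. by rewrite -ler_emb embD !emb_rnorm ler_normD. Qed.

Lemma rnormN x : rnorm (- x) = rnorm x.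
Proof. by rewrite /rnorm normrN. Qed.

Lemma rnormB x y : rnorm (x - y) <= rnorm x + rnorm y.
Proof. by rewrite -(rnormN y) rnormD. Qed.

Lemma rnorm0 : rnorm (0 : E) = 0.
Proof. by apply: emb_inj; rewrite emb_rnorm normr0 emb0. Qed.

Lemma rnorm_eq0 x : rnorm x = 0 -> x = 0.
Proof. by move=> h; apply/normr0_eq0; rewrite -emb_rnorm h emb0. Qed.

Lemma rnorm_sum (I : Type) (r : seq I) (P : pred I) (f : I -> E) :
  rnorm (\sum_(i <- r | P i) f i) <= \sum_(i <- r | P i) rnorm (f i).
Proof.
elim/big_rec2: _ => [|i y x _ h]; first by rewrite rnorm0.
by apply: (le_trans (rnormD _ _)); rewrite lerD2l.
Qed.

End Norm.
End Scalars.

(** * Signed sums and their moments *)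

(** All 2 ^ size xs sums a +- x_1 +- ... +- x_n, with repetitions, so that
    expectations over independent signs are sums over this list. *)
Fixpoint signed_sums (V : zmodType) (a : V) (xs : seq V) : seq V :=
  if xs is x :: xs' then signed_sums (a + x) xs' ++ signed_sums (a - x) xs' else [:: a].

Lemma size_signed_sums (V : zmodType) (a : V) xs :
  size (signed_sums a xs) = (2 ^ size xs)%N.
Proof.
by elim: xs a => //= x xs IH a; rewrite size_cat !IH expnS mul2n addnn.
Qed.

Lemma sum_signed_sums_const (R : pzRingType) (V : zmodType) (a : V) xs (c : R) :
  \sum_(y <- signed_sums a xs) c = 2 ^+ size xs * c.
Proof.
by rewrite big_const_seq count_predT size_signed_sums iter_addr_0 -[LHS]mulr_natl natrX.
Qed.

Lemma map_signed_sums (V W : zmodType) (f : V -> W) (a : V) xs :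
  {morph f : x y / x + y} -> {morph f : x y / x - y} ->
  map f (signed_sums a xs) = signed_sums (f a) (map f xs).
Proof.
by move=> fD fB; elim: xs a => //= x xs IH a; rewrite map_cat !IH fD fB.
Qed.

Section Moments.
Variables (R : realType) (s : scalar_kind).
Notation K := (scalar_field R s).

Lemma cabs_signed_sums_le (a : K) xs y : y \in signed_sums a xs ->
  cabs y <= cabs a + \sum_(x <- xs) cabs x.
Proof.
elim: xs a => [|x xs IH] a /=; first by rewrite inE big_nil addr0 => /eqP->.
rewrite mem_cat big_cons addrA => /orP[] /IH /le_trans; apply;
  rewrite lerD2r ?cabsD //.
by apply: (le_trans (cabsD _ _)); rewrite cabsN.
Qed.

(** Only the parallelogram law enters: the squares p and m of |a + x| and |a - x|
    have a known sum and both are at most (|a| + |x|)^2, which bounds p^2 + m^2.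
    So the real and the complex case need no separate treatment. *)
Lemma cabs_fourth (a x : K) : cabs (a + x) ^+ 4 + cabs (a - x) ^+ 4 <=
  2 * (cabs a ^+ 4 + 6 * cabs a ^+ 2 * cabs x ^+ 2 + cabs x ^+ 4).
Proof.
have := cabs_parallelogram a x.
have hp := cabsD a x; have := cabsD a (- x); rewrite cabsN => hm.
have p0 := cabs_ge0 (a + x); have m0 := cabs_ge0 (a - x).
have a0 := cabs_ge0 a; have x0 := cabs_ge0 x.
set p := cabs (a + x) in hp p0 *; set m := cabs (a - x) in hm m0 *.
set u := cabs a in hp hm a0 *; set v := cabs x in hp hm x0 *.
move=> e.
have hp2 : p ^+ 2 <= (u + v) ^+ 2 by rewrite ler_sqr ?nnegrE ?addr_ge0.
have hm2 : m ^+ 2 <= (u + v) ^+ 2 by rewrite ler_sqr ?nnegrE ?addr_ge0.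
have em : m ^+ 2 = 2 * (u ^+ 2 + v ^+ 2) - p ^+ 2 by lra.
have -> : m ^+ 4 = (m ^+ 2) ^+ 2 by rewrite -exprM.
have -> : p ^+ 4 = (p ^+ 2) ^+ 2 by rewrite -exprM.
rewrite em in hm2 *.
have : 0 <= ((u + v) ^+ 2 - p ^+ 2) *
  ((u + v) ^+ 2 - (2 * (u ^+ 2 + v ^+ 2) - p ^+ 2)).
  by rewrite mulr_ge0 // subr_ge0.
set P := p ^+ 2; rewrite -subr_ge0 => h.
rewrite -subr_ge0 (_ : _ - _ = 2 * ((u + v) ^+ 2 - P) *
  ((u + v) ^+ 2 - (2 * (u ^+ 2 + v ^+ 2) - P))); first by lra.
ring.
Qed.

(** The Khintchine inequality for the fourth moment, E |sum eps_j x_j|^4 <=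
    3 (sum |x_j|^2)^2; the starting point a is there for the induction. *)
Lemma signed_sums_moment4 (a : K) xs :
  \sum_(y <- signed_sums a xs) cabs y ^+ 4 <=
  (2 ^+ size xs) * (cabs a ^+ 4 + 6 * cabs a ^+ 2 * \sum_(x <- xs) cabs x ^+ 2
                    + 3 * (\sum_(x <- xs) cabs x ^+ 2) ^+ 2).
Proof.
elim: xs a => [|x xs IH] a /=.
  by rewrite big_seq1 big_nil mulr0 expr0n mulr0 !addr0 mul1r.
rewrite big_cat big_cons /=; apply: (le_trans (lerD (IH _) (IH _))).
rewrite -mulrDr (exprSr 2) -[leRHS]mulrA ler_wpM2l ?exprn_ge0 //.
have h4 := cabs_fourth a x; have h2 := cabs_parallelogram a x.
set S := \sum_(j <- xs) _.
have S0 : 0 <= S by rewrite sumr_ge0 // => i _; rewrite sqr_ge0.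
have hx : 0 <= cabs x ^+ 4 by rewrite exprn_ge0 ?cabs_ge0.
set p := cabs (a + x) in h4 h2 *; set m := cabs (a - x) in h4 h2 *.
have -> : p ^+ 4 + 6 * p ^+ 2 * S + 3 * S ^+ 2
  + (m ^+ 4 + 6 * m ^+ 2 * S + 3 * S ^+ 2) =
  (p ^+ 4 + m ^+ 4) + 6 * (p ^+ 2 + m ^+ 2) * S + 6 * S ^+ 2 by ring.
rewrite h2.
apply: (le_trans (lerD (lerD h4 (lexx _)) (lexx _))).
rewrite -subr_ge0 (_ : _ - _ = 4 * cabs x ^+ 4); first by rewrite mulr_ge0.
ring.
Qed.

End Moments.

(** * Maurey's summing theorem on the cube *)

Section QConvex.
Variables (R : realType) (s : scalar_kind) (q : R).
Notation K := (scalar_field R s).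

(** The properties of x |-> ||u x|| ^ q, for a linear map u, that the estimates on
    the cube use. Unlike functions of that form for a fixed target space, they
    are stable under sums. *)
Definition qconvex (V : lmodType K) (Phi : V -> R) : Prop :=
  [/\ forall x, 0 <= Phi x,
      forall r x, 0 <= r -> Phi (emb s r *: x) = r `^ q * Phi x &
      forall t x y, 0 <= t <= 1 ->
        Phi (emb s t *: x + emb s (1 - t) *: y) <= t * Phi x + (1 - t) * Phi y].

(** The cotype inequality sum_j Phi (x_j) <= C E Phi (sum_j eps_j x_j), multiplied
    by the number of signs. *)
Definition rcotype (C : R) (V : lmodType K) (Phi : V -> R) : Prop :=
  forall xs : seq V, 2 ^+ size xs * (\sum_(x <- xs) Phi x) <=
    C * \sum_(y <- signed_sums 0 xs) Phi y.

Lemma qconvex_sum (V : lmodType K) (I : Type) (r : seq I) (Phi : I -> V -> R) :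
  (forall i, qconvex (Phi i)) -> qconvex (fun x => \sum_(i <- r) Phi i x).
Proof.
move=> h; split=> [x|c x c0|t x y t01].
- by apply: sumr_ge0 => i _; case: (h i).
- by rewrite mulr_sumr; apply: eq_bigr => i _; case: (h i) => _ ->.
- by rewrite !mulr_sumr -big_split; apply: ler_sum => i _; case: (h i) => _ _; apply.
Qed.

Lemma rcotype_sum C (V : lmodType K) (I : Type) (r : seq I) (Phi : I -> V -> R) :
  (forall i, rcotype C (Phi i)) -> rcotype C (fun x => \sum_(i <- r) Phi i x).
Proof.
move=> h xs; rewrite exchange_big /= [X in C * X]exchange_big /= !mulr_sumr.
by apply: ler_sum => i _; apply: h.
Qed.

Lemma qconvex_comp (V W : lmodType K) (f : V -> W) (Phi : W -> R) :
  linear f -> qconvex Phi -> qconvex (Phi \o f).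
Proof.
move=> lf [h1 h2 h3].
have fZ := GRing.scalable_linear lf.
split=> [x|c x c0|t x y t01] /=; first exact: h1.
- by rewrite fZ h2.
- by rewrite lf fZ h3.
Qed.

Lemma rcotype_comp C (V W : lmodType K) (f : V -> W) (Phi : W -> R) :
  linear f -> rcotype C Phi -> rcotype C (Phi \o f).
Proof.
move=> lf h xs; have fB := GRing.zmod_morphism_linear lf.
have f0 : f 0 = 0 by rewrite -(subrr 0) fB subrr.
have := h (map f xs); rewrite size_map big_map => /le_trans; apply.
rewrite -[X in signed_sums X]f0 -map_signed_sums ?big_map // => x y.
by rewrite -[x]scale1r lf !scale1r.
Qed.

Section OneFunction.
Variables (V : lmodType K) (Phi : V -> R).
Hypothesis hPhi : qconvex Phi.

Lemma qconvex_add x y : Phi (x + y) <= 2 `^ q / 2 * (Phi x + Phi y).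
Proof.
case: hPhi => _ hZ hC.
have e : x + y = emb s 2 *: (emb s 2^-1 *: x + emb s (1 - 2^-1) *: y).
  have -> : 1 - 2^-1 = 2^-1 :> R by field.
  by rewrite -scalerDr scalerA -embM divff // emb1 scale1r.
rewrite e hZ // -mulrA ler_wpM2l ?powR_ge0 //.
apply: (le_trans (hC _ _ _ _)); first by lra.
by lra.
Qed.

Lemma qconvex_mean (xs : seq V) : xs != [::] ->
  (size xs)%:R * Phi (emb s (size xs)%:R^-1 *: \sum_(x <- xs) x) <=
  \sum_(x <- xs) Phi x.
Proof.
case: hPhi => _ _ hC.
elim: xs => // x [|y xs] IH _.
  by rewrite !big_seq1 /= mul1r invr1 emb1 scale1r.
rewrite big_cons [X in _ <= X]big_cons; have {IH} := IH isT.
set ys := y :: xs; set S := \sum_(_ <- _) _; set T := \sum_(_ <- _) _.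
move=> IH /=; set n : R := (size xs).+1%:R.
have n0 : 0 < n by rewrite ltr0n.
have -> : (size xs).+2%:R = 1 + n :> R by rewrite -natr1 addrC.
have np : 0 < 1 + n by lra.
have e : emb s (1 + n)^-1 *: (x + S) =
   emb s (1 + n)^-1 *: x + emb s (1 - (1 + n)^-1) *: (emb s n^-1 *: S).
  rewrite scalerDr scalerA -embM; congr (_ + emb s _ *: _).
  by field; lra.
have t01 : 0 <= (1 + n)^-1 <= 1.
  by rewrite invr_ge0 ltW //= invf_le1 //; lra.
rewrite e -ler_pdivlMl //; apply: (le_trans (hC _ _ _ t01)).
rewrite -ler_pdivlMl // in IH.
rewrite mulrDr lerD2l.
have -> : (1 + n)^-1 * T = (1 - (1 + n)^-1) * (n^-1 * T) by field; lra.
by rewrite ler_wpM2l // subr_ge0; case/andP: t01.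
Qed.

End OneFunction.
End QConvex.

Section Linear.
Variables (R : realType) (s : scalar_kind) (q : R) (d : nat).
Notation K := (scalar_field R s).
Notation V := 'rV[K]_d.
Hypothesis q2 : 2 <= q.

(** Since the extreme functionals on l_oo^d are the coordinates up to a scalar,
    this says that the p-th power of the weak p-norm of xs is at most c. *)
Definition weakly_le (p : nat) (c : R) (xs : seq V) : Prop :=
  forall i, \sum_(x <- xs) cabs (x 0 i) ^+ p <= c.

Definition in_cube (x : V) : Prop := forall i, cabs (x 0 i) <= 1.

Definition cmul (h : 'I_d -> R) (x : V) : V := \row_i (emb s (h i) * x 0 i).

Lemma cabs_cmul h x i : cabs (cmul h x 0 i) = `|h i| * cabs (x 0 i).
Proof. by rewrite mxE cabsM cabs_emb. Qed.

Variables (Phi : V -> R) (C M : R).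
Hypotheses (hPhi : qconvex q Phi) (cPhi : rcotype C Phi) (C0 : 0 <= C).
Hypothesis bPhi : forall x, in_cube x -> Phi x <= M.

Let Phi_ge0 x : 0 <= Phi x. Proof. by case: hPhi. Qed.
Let q1 : 1 <= q. Proof. by apply: le_trans q2; rewrite ler1n. Qed.

Lemma cube_bound_ge0 : 0 <= M.
Proof.
apply: (le_trans (Phi_ge0 0)); apply: bPhi => i; by rewrite mxE cabs0.
Qed.

Lemma sum_signed_sums_le xs (b : R) :
  (forall y, y \in signed_sums 0 xs -> Phi y <= b) -> \sum_(x <- xs) Phi x <= C * b.
Proof.
move=> h; rewrite -(@ler_pM2l _ (2 ^+ size xs)) ?exprn_gt0 //.
apply: (le_trans (cPhi xs)); rewrite mulrCA ler_wpM2l //.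
rewrite big_seq; apply: (le_trans (ler_sum _ h)).
by rewrite -big_seq sum_signed_sums_const.
Qed.

(** If sum_j |x_j(i)| <= 1 then every signed sum stays in the cube, so cotype alone
    gives the bound. *)
Lemma sum_le_1weak xs : weakly_le 1 1 xs -> \sum_(x <- xs) Phi x <= C * M.
Proof.
move=> h; apply: sum_signed_sums_le => y hy; apply: bPhi => i.
have hi : y 0 i \in signed_sums ((0 : V) 0 i) [seq x 0 i | x : V <- xs].
  rewrite -(map_signed_sums (f := fun x : V => x 0 i)) => [|u v|u v].
  - exact: map_f.
  - by rewrite mxE.
  - by rewrite !mxE.
rewrite mxE in hi.
apply: (le_trans (cabs_signed_sums_le hi)); rewrite cabs0 add0r big_map.
by apply: le_trans (h i); rewrite le_eqVlt; apply/orP; left; apply/eqP/eq_bigr.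
Qed.

Lemma Phi_scale (c : R) x : 0 < c ->
  Phi x = c `^ q * Phi (emb s c^-1 *: x).
Proof.
case: hPhi => _ hZ _ c0.
by rewrite -hZ ?ltW // scalerA -embM divff ?gt_eqF // emb1 scale1r.
Qed.

Lemma sum_scale (c : R) (xs : seq V) : 0 < c ->
  \sum_(x <- xs) Phi x =
  c `^ q * \sum_(x <- [seq emb s c^-1 *: x | x <- xs]) Phi x.
Proof.
move=> c0; rewrite big_map mulr_sumr; apply: eq_bigr => x _; exact: Phi_scale.
Qed.

Lemma weakly_le_scale p (c b : R) (xs : seq V) : 0 < c ->
  weakly_le p (c ^+ p * b) xs -> weakly_le p b [seq emb s c^-1 *: x | x <- xs].
Proof.
move=> c0 h i; rewrite big_map -(ler_pM2l (exprn_gt0 p c0)) mulr_sumr.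
apply: le_trans (h i); rewrite le_eqVlt; apply/orP; left; apply/eqP.
apply: eq_bigr => x _; rewrite !mxE cabsM cabs_emb exprMn mulrA -exprMn.
by rewrite gtr0_norm ?invr_gt0 // divff ?gt_eqF // expr1n mul1r.
Qed.

Definition small_part (t : R) (x : V) : V :=
  cmul (fun i => if cabs (x 0 i) <= t then 1 else 0) x.
Definition large_part (t : R) (x : V) : V :=
  cmul (fun i => if t < cabs (x 0 i) then 1 else 0) x.

Lemma small_large t x : small_part t x + large_part t x = x.
Proof.
apply/rowP => i; rewrite !mxE ltNge -mulrDl.
by case: (_ <= t); rewrite ?emb1 ?emb0 ?addr0 ?add0r mul1r.
Qed.

Lemma cabs_small_part t x i :
  cabs (small_part t x 0 i) = if cabs (x 0 i) <= t then cabs (x 0 i) else 0.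
Proof.
by rewrite cabs_cmul; case: ifP; rewrite ?normr1 ?normr0 ?mul1r ?mul0r.
Qed.

Lemma cabs_large_part t x i :
  cabs (large_part t x 0 i) = if t < cabs (x 0 i) then cabs (x 0 i) else 0.
Proof.
by rewrite cabs_cmul; case: ifP; rewrite ?normr1 ?normr0 ?mul1r ?mul0r.
Qed.

Lemma Phi_small_part t x : 0 < t -> Phi (small_part t x) <= t `^ q * M.
Proof.
move=> t0; rewrite (Phi_scale _ t0) ler_wpM2l ?powR_ge0 // bPhi // => i.
rewrite mxE cabsM cabs_emb gtr0_norm ?invr_gt0 // ler_pdivrMl // mulr1.
by rewrite cabs_small_part; case: ifP => // _; apply: ltW.
Qed.

Definition summing_values : set R :=
  [set r | exists2 xs, weakly_le 2 1 xs & r = \sum_(x <- xs) Phi x]%classic.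
(** The best constant in sum_j Phi (x_j) <= pi over the families xs of weak 2-norm
    at most 1. *)
Definition summing_const : R := sup summing_values.

(** Finiteness of the best constant, with a bound that depends on d: Phi (x) is at
    most the q-th power of the sup norm of x, times M, and q >= 2. *)
Lemma has_sup_summing : has_sup summing_values.
Proof.
split; first by exists 0, [::] => [i|]; rewrite !big_nil.
exists (d%:R * M) => _ [xs h ->].
have le x : x \in xs -> Phi x <= (\sum_i cabs (x 0 i) ^+ 2) * M.
  move=> xxs; set S := \sum_i _; set t := \big[Num.max/0]_i cabs (x 0 i).
  have c2 i : cabs (x 0 i) ^+ 2 <= S.
    by rewrite /S (bigD1 i) //= lerDl sumr_ge0 // => j _; rewrite sqr_ge0.
  have S0 : 0 <= S by rewrite sumr_ge0 // => j _; rewrite sqr_ge0.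
  have ct i : cabs (x 0 i) <= t by apply: le_bigmax.
  have tS : t <= Num.sqrt S.
    apply/bigmax_leP; split=> [|i _]; first exact: sqrtr_ge0.
    by rewrite -(ger0_norm (cabs_ge0 _)) -sqrtr_sqr ler_wsqrtr.
  have t1 : t <= 1.
    apply/bigmax_leP; split=> // i _.
    rewrite -(@ler_pXn2r _ 2) ?nnegrE ?cabs_ge0 // expr1n.
    apply: le_trans (h i); rewrite (big_rem x) //= lerDl sumr_ge0 // => y _.
    by rewrite sqr_ge0.
  have : 0 <= t by apply: bigmax_ge_id.
  rewrite le_eqVlt => /orP[/eqP t0|t0].
    have -> : x = emb s 0 *: x.
      apply/rowP => i; have := ct i; rewrite -t0 => c0.
      have : cabs (x 0 i) = 0 by apply/eqP; rewrite eq_le c0 cabs_ge0.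
      move=> /(congr1 (@emb R s)); rewrite emb_cabs emb0 => /normr0_eq0 xi.
      by rewrite mxE xi mulr0.
    case: hPhi => _ -> // _.
    by rewrite powR0 ?mul0r ?mulr_ge0 ?cube_bound_ge0 // gt_eqF // (lt_le_trans _ q1).
  rewrite (Phi_scale _ t0) ler_pM ?powR_ge0 //.
    apply: (@le_trans _ _ (t ^+ 2)).
      by rewrite -powR_mulrn ?(ltW t0) // ger_powR ?t0.
    by rewrite -(sqr_sqrtr S0) ler_pXn2r ?nnegrE ?sqrtr_ge0 ?(ltW t0).
  apply: bPhi => i.
  by rewrite mxE cabsM cabs_emb gtr0_norm ?invr_gt0 // ler_pdivrMl // mulr1.
rewrite big_seq; apply: (le_trans (ler_sum _ le)).
rewrite -big_seq -mulr_suml ler_wpM2r ?cube_bound_ge0 // exchange_big /=.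
apply: (@le_trans _ _ (\sum_(i < d) 1)); first by apply: ler_sum => i _; apply: h.
by rewrite sumr_const card_ord.
Qed.

Lemma summing_const_ub xs : weakly_le 2 1 xs ->
  \sum_(x <- xs) Phi x <= summing_const.
Proof.
by move=> h; apply: sup_upper_bound; [exact: has_sup_summing|exists xs].
Qed.

Lemma summing_const_le b : (forall xs, weakly_le 2 1 xs ->
  \sum_(x <- xs) Phi x <= b) -> summing_const <= b.
Proof.
move=> h; apply: ge_sup; first by have [] := has_sup_summing.
by move=> _ [xs /h ? ->].
Qed.

Lemma sum_le_2weak c xs : 0 < c -> weakly_le 2 (c ^+ 2) xs ->
  \sum_(x <- xs) Phi x <= c `^ q * summing_const.
Proof.
move=> c0 h; rewrite (sum_scale _ c0) ler_wpM2l ?powR_ge0 //.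
by apply: summing_const_ub; apply: weakly_le_scale; rewrite // mulr1.
Qed.

Lemma summing_const_ge0 : 0 <= summing_const.
Proof.
have /summing_const_ub : weakly_le 2 1 [::] by move=> i; rewrite big_nil.
by rewrite big_nil.
Qed.

(** Maurey's argument. With Y = sum_j eps_j x_j and L = 12 C + 1, the part of Y
    above L has second moment at most 3 / L^2 at each coordinate, and for q = 2
    this alone lets it be estimated by the best constant P; hence
    P <= 2 C L^2 M + P / 2. *)
Lemma summing_const_2 : q = 2 -> summing_const <= 4 * C * (12 * C + 1) ^+ 2 * M.
Proof.
move: C0 => C0' q2e; set L := 12 * C + 1; set P := summing_const.
have L1 : 1 <= L by rewrite /L; lra.
have L0 : 0 < L by lra.
have P0 : 0 <= P := summing_const_ge0.
suff : P <= 2 * C * L ^+ 2 * M + P / 2.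
  by move: (L ^+ 2) => L2; rewrite -!mulrA => hP; lra.
apply: summing_const_le => xs h.
rewrite -(@ler_pM2l _ (2 ^+ size xs)) ?exprn_gt0 //.
apply: (le_trans (cPhi xs)).
set N := 2 ^+ size xs.
have N0 : 0 < N by rewrite exprn_gt0.
have split y : Phi y <= 2 * (L ^+ 2 * M + Phi (large_part L y)).
  rewrite -{1}(small_large L y); apply: (le_trans (qconvex_add hPhi _ _)).
  rewrite q2e powR_mulrn // (_ : 2 ^+ 2 / 2 = 2); last by field.
  rewrite ler_wpM2l // lerD2r; have := Phi_small_part y L0.
  by rewrite q2e powR_mulrn // ltW.
have large : \sum_(y <- signed_sums 0 xs) Phi (large_part L y) <= N * 3 / L ^+ 2 * P.
  rewrite -(big_map (large_part L) xpredT Phi).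
  have c0 : 0 < N * 3 / L ^+ 2 by rewrite divr_gt0 ?exprn_gt0 ?mulr_gt0.
  rewrite -(sqr_sqrtr (ltW c0)).
  have <- : Num.sqrt (N * 3 / L ^+ 2) `^ q = Num.sqrt (N * 3 / L ^+ 2) ^+ 2.
    by rewrite q2e powR_mulrn ?sqrtr_ge0.
  apply: sum_le_2weak; first by rewrite sqrtr_gt0.
  rewrite sqr_sqrtr ?(ltW c0) // => i; rewrite big_map.
  apply: (@le_trans _ _ (\sum_(y <- signed_sums 0 xs) cabs (y 0 i) ^+ 4 / L ^+ 2)).
    apply: ler_sum => y _; rewrite cabs_large_part; case: ifP => [Ly|_].
      rewrite ler_pdivlMr ?exprn_gt0 // (_ : 4 = 2 + 2)%N // exprD.
      by rewrite ler_wpM2l ?sqr_ge0 // ler_pXn2r ?nnegrE ?cabs_ge0 // ltW.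
    by rewrite expr0n /= divr_ge0 ?exprn_ge0 ?cabs_ge0 ?ltW.
  rewrite -mulr_suml ler_wpM2r ?invr_ge0 ?sqr_ge0 //.
  rewrite -(big_map (fun x : V => x 0 i) xpredT (fun z => cabs z ^+ 4)).
  rewrite map_signed_sums => [|u v|u v]; rewrite ?mxE //.
  apply: (le_trans (signed_sums_moment4 _ _)); rewrite size_map -/N ler_wpM2l ?(ltW N0) //.
  rewrite cabs0 !expr0n /= mulr0 mul0r !add0r big_map.
  rewrite ler_piMr // expr_le1 ?h //.
  by rewrite sumr_ge0 // => x _; rewrite sqr_ge0.
apply: (@le_trans _ _ (C * (N * (2 * (L ^+ 2 * M))
   + 2 * (N * 3 / L ^+ 2 * P)))).
  rewrite ler_wpM2l //.
  apply: (le_trans (ler_sum _ (fun y _ => split y))).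
  rewrite -mulr_sumr big_split /= mulrDr lerD ?ler_wpM2l //.
  by rewrite sum_signed_sums_const -/N mulrCA.
have -> : C * (N * (2 * (L ^+ 2 * M)) + 2 * (N * 3 / L ^+ 2 * P)) =
  N * (2 * C * L ^+ 2 * M + (6 * C / L ^+ 2) * P) by ring.
rewrite ler_wpM2l ?(ltW N0) // lerD2l mulrC ler_wpM2l //.
rewrite ler_pdivrMr ?exprn_gt0 //.
have : L <= L ^+ 2 by rewrite expr2 ler_peMr ?(ltW L0).
by rewrite {1}/L => hL; lra.
Qed.

(** For y in the cube, the family of the x (1 - |y|^2), x in xs, followed by y, has
    again weak 2-norm at most 1, so its sum is at most the best constant P. Average
    this over y in ys. By convexity the average of Phi (x (1 - |y|^2)) is at
    least Phi (x (1 - g)), where g is the mean of |y|^2 and is at most th = N / J,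
    J the size of ys. Convexity on the segment from x (1 + g / th) to
    x (1 - g), which contains x, shows that this is not much below Phi x. What is
    left bounds the sum of Phi over ys. *)
Lemma pisier_perturbation xs ys N : 0 < N -> weakly_le 2 1 xs ->
  (forall y, y \in ys -> in_cube y) -> weakly_le 2 N ys ->
  \sum_(y <- ys) Phi y <= (size ys)%:R * (summing_const - \sum_(x <- xs) Phi x)
     + 2 `^ q * N * summing_const.
Proof.
move=> N0 hx ycube hy; set P := summing_const.
have P0 : 0 <= P := summing_const_ge0.
set A := \sum_(x <- xs) Phi x; have AP : A <= P := summing_const_ub hx.
have q20 : 0 < 2 `^ q :> R by rewrite powR_gt0.
have [->|ys0] := eqVneq ys [::].
  by rewrite big_nil mul0r add0r !mulr_ge0 // ltW.
set J : R := (size ys)%:R; have J0 : 0 < J by rewrite ltr0n lt0n size_eq0.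
pose w (y : V) i := cabs (y 0 i) ^+ 2.
have w01 y i : y \in ys -> 0 <= w y i <= 1.
  by move=> /ycube yc; rewrite sqr_ge0 /= expr_le1 ?cabs_ge0 ?yc.
pose th := N / J; have th0 : 0 < th by rewrite divr_gt0.
pose g i := J^-1 * \sum_(y <- ys) w y i.
have g0 i : 0 <= g i.
  by rewrite mulr_ge0 ?invr_ge0 ?(ltW J0) // sumr_ge0 // => y _; rewrite sqr_ge0.
have gth i : g i <= th by rewrite /th mulrC ler_wpM2l ?invr_ge0 ?(ltW J0) ?hy.
pose S := \sum_(x <- xs) Phi (cmul (fun i => 1 - g i) x).
have one y : y \in ys ->
    \sum_(x <- xs) Phi (cmul (fun i => 1 - w y i) x) + Phi y <= P.
  move=> yys; rewrite addrC -(big_map (cmul (fun i => 1 - w y i)) xpredT Phi).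
  rewrite -(big_cons _ _ y _ xpredT); apply: summing_const_ub => i.
  rewrite big_cons big_map -/(w y i); have /andP[wy0 wy1] := w01 y i yys.
  rewrite (eq_bigr (fun x : V => (1 - w y i) ^+ 2 * cabs (x 0 i) ^+ 2)); last first.
    by move=> x _; rewrite cabs_cmul exprMn real_normK ?num_real.
  rewrite -mulr_sumr.
  have : (1 - w y i) ^+ 2 * (\sum_(x <- xs) cabs (x 0 i) ^+ 2) <= (1 - w y i) ^+ 2.
    by rewrite ler_piMr ?sqr_ge0 ?hx.
  by move: (\sum_(x <- xs) _) => T hT; nra.
have JS : J * S + \sum_(y <- ys) Phi y <= J * P.
  apply: (@le_trans _ _ (\sum_(y <- ys) P)); last first.
    by rewrite big_const_seq count_predT iter_addr_0 -[leLHS]mulr_natl.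
  rewrite [leRHS]big_seq; apply: le_trans (ler_sum _ one).
  rewrite -big_seq big_split /= lerD2r exchange_big /= mulr_sumr.
  apply: ler_sum => x _.
  rewrite -(big_map (fun y => cmul (fun i => 1 - w y i) x) xpredT Phi).
  have := qconvex_mean hPhi (xs := [seq cmul (fun i => 1 - w y i) x | y <- ys]).
  rewrite size_map => mean; apply: le_trans (mean _); last by case: (ys) ys0.
  rewrite -/J ler_wpM2l ?(ltW J0) // le_eqVlt; apply/orP; left; apply/eqP.
  congr Phi; apply/rowP => i; rewrite big_map !mxE summxE.
  rewrite (eq_bigr (fun y => emb s (1 - w y i) * x 0 i)) => [|y _]; last by rewrite mxE.
  rewrite -mulr_suml -rmorph_sum mulrA /= -embM sumrB big_const_seq count_predT.
  rewrite iter_addr_0 -/J mulrBr mulVf ?gt_eqF //.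
(* x is the convex combination of x (1 - g) and x (1 + g / th) with weights
   1 / (1 + th) and th / (1 + th); the second family is at most twice xs. *)
have AS : (1 + th) * A <= S + th * (2 `^ q * P).
  pose h i := 1 + th^-1 * g i.
  have h12 i : `|h i| <= 2.
    have tg : 0 <= th^-1 * g i by apply: mulr_ge0; rewrite ?g0 ?invr_ge0 ?(ltW th0).
    rewrite ger0_norm /h; last exact: addr_ge0.
    by rewrite /h lerD2l ler_pdivrMl // mulr1.
  have big : \sum_(x <- xs) Phi (cmul h x) <= 2 `^ q * P.
    rewrite -(big_map (cmul h) xpredT Phi); apply: (@sum_le_2weak 2) => // => i.
    rewrite big_map; apply: (@le_trans _ _ (\sum_(x <- xs) 2 ^+ 2 * cabs (x 0 i) ^+ 2)).
      apply: ler_sum => x _; rewrite cabs_cmul exprMn ler_wpM2r ?sqr_ge0 //.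
      by rewrite ler_pXn2r ?nnegrE.
    by rewrite -mulr_sumr ler_piMr ?sqr_ge0 ?hx.
  have : th * (\sum_(x <- xs) Phi (cmul h x)) <= th * (2 `^ q * P).
    by rewrite ler_wpM2l ?(ltW th0).
  rewrite -(lerD2l S); apply: le_trans; rewrite /A /S !mulr_sumr -big_split /=.
  apply: ler_sum => x _; case: hPhi => _ _ hC.
  have t0 : 0 < 1 + th by lra.
  have t01 : 0 <= (1 + th)^-1 <= 1.
    by rewrite invr_ge0 ltW //= invf_le1 //; lra.
  have e : x = emb s (1 + th)^-1 *: cmul (fun i => 1 - g i) x +
     emb s (1 - (1 + th)^-1) *: cmul h x.
    apply/rowP => i; rewrite !mxE !mulrA -!embM -mulrDl -embD.
    have -> : (1 + th)^-1 * (1 - g i) + (1 - (1 + th)^-1) * h i = 1.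
      by rewrite /h; move: (g i) (th) th0 t0 => a b b0 b1; field; rewrite !gt_eqF.
    by rewrite emb1 mul1r.
  have := hC _ (cmul (fun i => 1 - g i) x) (cmul h x) t01; rewrite -e => ht.
  rewrite -ler_pdivlMl //; apply: (le_trans ht).
  by rewrite le_eqVlt; apply/orP; left; apply/eqP; field; rewrite gt_eqF.
suff : J * A <= J * S + N * (2 `^ q * P) by lra.
have -> : N = J * th by rewrite /th mulrC divfK ?gt_eqF.
rewrite -mulrA -mulrDr ler_wpM2l ?(ltW J0) //.
apply: le_trans AS; rewrite mulrDl mul1r lerDl mulr_ge0 ?(ltW th0) //.
by rewrite /A sumr_ge0.
Qed.

(** Let xs in the perturbation estimate be almost extremal. The gain over the
    trivial bound N ^ (q / 2) P is that N enters linearly. *)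
Lemma pisier_bounded_family ys N : 0 < N ->
  (forall y, y \in ys -> in_cube y) -> weakly_le 2 N ys ->
  \sum_(y <- ys) Phi y <= 2 `^ q * N * summing_const.
Proof.
move=> N0 ycube hy; set P := summing_const.
have P0 : 0 <= P := summing_const_ge0.
apply/ler_addgt0Pr => e e0.
have J0 : 0 < (size ys).+1%:R :> R by rewrite ltr0n.
have [_ [xs hx ->] hs] := sup_adherent (divr_gt0 e0 J0) has_sup_summing.
apply: (le_trans (pisier_perturbation N0 hx ycube hy)); rewrite addrC lerD2l.
apply: (@le_trans _ _ ((size ys).+1%:R * (summing_const - \sum_(x <- xs) Phi x))).
  by rewrite ler_wpM2r ?subr_ge0 ?summing_const_ub // ler_nat.
rewrite -ler_pdivlMl // mulrC lerBlDr -lerBlDl; exact: ltW.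
Qed.

(** L is chosen so that the small parts contribute at most P / 2: they are bounded by
    1 / L with weak 2-norm at most 1, and scaling them to the cube gives
    2 ^ q L ^ (2 - q) P, whose exponent of L is negative because q > 2. The
    large parts satisfy |x_j(i)| <= L |x_j(i)|^2, so their weak 1-norm is at
    most L. *)
Lemma summing_const_gt2 : 2 < q ->
  summing_const <=
  2 `^ q * (((2 `^ q) ^+ 2) `^ (q - 2)^-1) `^ q * C * M.
Proof.
move=> q2'; set L := _ `^ (q - 2)^-1; set P := summing_const.
have P0 : 0 <= P := summing_const_ge0.
have M0 := cube_bound_ge0; have C0' := C0.
set Q := 2 `^ q; have Q1 : 1 <= Q.
  by rewrite -(powRr0 2) ler_powR ?ler1n // (le_trans _ q1).
have L0 : 0 < L by rewrite powR_gt0 // exprn_gt0 // powR_gt0.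
have LE : L `^ (q - 2) = Q ^+ 2.
  by rewrite -powRrM mulVf ?powRr1 ?sqr_ge0 // subr_eq0 gt_eqF.
have Lq : L `^ q = Q ^+ 2 * L ^+ 2.
  by rewrite -LE -powR_mulrn ?(ltW L0) // -powRD ?subrK // (gt_eqF L0) implybT.
set T := L `^ q in Lq *; have T0 : 0 < T by rewrite powR_gt0.
suff : P <= Q / 2 * (Q * L ^+ 2 / T * P + T * (C * M)).
  rewrite {1}Lq; have -> : Q * L ^+ 2 / (Q ^+ 2 * L ^+ 2) = Q^-1.
    by field; rewrite !gt_eqF //; lra.
  rewrite mulrDr mulrA (_ : Q / 2 / Q = 2^-1); last by field; rewrite gt_eqF //; lra.
  by rewrite -!mulrA; set U := Q * (T * _); rewrite mulrCA -/U => h; lra.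
apply: summing_const_le => xs hx.
have iL0 : 0 < L^-1 by rewrite invr_gt0.
have small : \sum_(x <- xs) Phi (small_part L^-1 x) <= Q * L ^+ 2 / T * P.
  rewrite -(big_map (small_part L^-1) xpredT Phi) (sum_scale _ iL0).
  rewrite (_ : _ `^ q = T^-1); last by rewrite /T -powR_inv1 ?ltW // powRAC powR_inv1 ?ltW.
  have -> : Q * L ^+ 2 / T * P = T^-1 * (Q * L ^+ 2 * P) by rewrite mulrAC mulrC.
  rewrite ler_wpM2l ?invr_ge0 ?(ltW T0) //.
  apply: pisier_bounded_family; first by rewrite exprn_gt0.
    move=> _ /mapP[_ /mapP[x _ ->] ->] i; rewrite mxE cabsM cabs_emb invrK.
    rewrite gtr0_norm // -ler_pdivlMl // mulr1 cabs_small_part.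
    by case: ifP => // _; apply: ltW.
  apply: weakly_le_scale => // i; rewrite exprVn mulVf ?expf_neq0 ?gt_eqF //.
  apply: le_trans (hx i); rewrite big_map; apply: ler_sum => x _.
  by rewrite cabs_small_part; case: ifP => // _; rewrite expr0n sqr_ge0.
have large : \sum_(x <- xs) Phi (large_part L^-1 x) <= T * (C * M).
  rewrite -(big_map (large_part L^-1) xpredT Phi) (sum_scale _ L0) ler_wpM2l ?(ltW T0) //.
  apply/sum_le_1weak/weakly_le_scale => // i; rewrite mulr1 expr1 -[leRHS]mulr1.
  apply: le_trans (ler_wpM2l (ltW L0) (hx i)).
  rewrite big_map mulr_sumr; apply: ler_sum => x _; rewrite expr1 cabs_large_part.
  case: ifP => hL; last by rewrite mulr_ge0 ?sqr_ge0 ?(ltW L0).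
  rewrite expr2 mulrA ler_peMl ?cabs_ge0 // -ler_pdivrMl // mulr1; exact: ltW.
apply: (@le_trans _ _ (Q / 2 * (\sum_(x <- xs) Phi (small_part L^-1 x) +
    \sum_(x <- xs) Phi (large_part L^-1 x)))).
  rewrite -big_split mulr_sumr; apply: ler_sum => x _.
  by rewrite -{1}(small_large L^-1 x); apply: qconvex_add.
by rewrite ler_wpM2l ?divr_ge0 ?lerD //; lra.
Qed.

End Linear.

(** kappa has to serve all Phi at once: it is applied to functions Phi that are
    themselves sums over other families. *)
Definition summing_on_cube (R : realType) (s : scalar_kind) (q C : R) (d : nat)
    (kappa : R) : Prop :=
  forall (Phi : 'rV[scalar_field R s]_d -> R) (M : R),
    qconvex q Phi -> rcotype C Phi -> (forall x, in_cube x -> Phi x <= M) ->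
  forall xs, weakly_le 2 1 xs -> \sum_(x <- xs) Phi x <= kappa * M.

Lemma linear_summing (R : realType) (s : scalar_kind) (q C : R) : 2 <= q -> 0 <= C ->
  exists2 kappa : R, 0 <= kappa & forall d, summing_on_cube s q C d kappa.
Proof.
move=> q2 C0.
have [e|/eqP ne] := eqVneq q 2.
  exists (4 * C * (12 * C + 1) ^+ 2) => [|d Phi M h1 h2 h3 xs hx].
    by have := sqr_ge0 (12 * C + 1); nra.
  apply: le_trans (summing_const_ub q2 h1 h3 hx) _.
  exact: (summing_const_2 q2 h1 h2 C0 h3 e).
exists (2 `^ q * (((2 `^ q) ^+ 2) `^ (q - 2)^-1) `^ q * C)
  => [|d Phi M h1 h2 h3 xs hx].
  by rewrite !mulr_ge0 ?powR_ge0.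
apply: le_trans (summing_const_ub q2 h1 h3 hx) _.
by apply: summing_const_gt2 => //; rewrite lt_neqAle q2 andbT eq_sym; apply/eqP.
Qed.

(** * Multilinear maps, one slot at a time *)

Lemma powR_convex (R : realType) (q t x y : R) : 1 <= q -> 0 <= t <= 1 ->
  0 <= x -> 0 <= y ->
  (t * x + (1 - t) * y) `^ q <= t * x `^ q + (1 - t) * y `^ q.
Proof.
move=> q1 /andP[t0 t1] x0 y0.
have ht : Itv.spec (@Itv.num_sem R) (Itv.Real `[0%Z, 1%Z]) t.
  by rewrite /Itv.spec /= /Itv.num_sem /= num_real in_itv /= t0 t1.
have := @convex_powR R q q1 (Itv.Def ht) x y.
rewrite !inE /= !in_itv /= !andbT => /(_ x0 y0).
by rewrite !convRE /=.
Qed.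

Lemma weakly_le_cube (R : realType) (s : scalar_kind) (d : nat)
    (xs : seq 'rV[scalar_field R s]_d) x :
  weakly_le 2 1 xs -> x \in xs -> in_cube x.
Proof.
move=> h xxs i; rewrite -(@ler_pXn2r _ 2) ?nnegrE ?cabs_ge0 // expr1n.
apply: le_trans (h i); rewrite (big_rem x) //= lerDl sumr_ge0 // => y _.
by rewrite sqr_ge0.
Qed.

Lemma qconvex_rnorm (R : realType) (s : scalar_kind) (q : R)
    (F : normedModType (scalar_field R s)) : 1 <= q ->
  qconvex q (fun x : F => rnorm x `^ q).
Proof.
move=> q1; split=> [x|r x r0|t x y t01]; first exact: powR_ge0.
  by rewrite rnormZ cabs_emb ger0_norm // powRM ?rnorm_ge0.
have /andP[t0 t1] := t01.
apply: (le_trans _ (powR_convex q1 t01 (rnorm_ge0 _) (rnorm_ge0 _))).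
apply: (ge0_ler_powR (le_trans ler01 q1)); rewrite ?nnegrE ?rnorm_ge0 //.
  by rewrite addr_ge0 ?mulr_ge0 ?rnorm_ge0 ?subr_ge0.
apply: (le_trans (rnormD _ _)).
by rewrite !rnormZ !cabs_emb !ger0_norm ?subr_ge0.
Qed.

Section Multilinear.
Variables (R : realType) (s : scalar_kind) (q C : R) (d k : nat).
Notation K := (scalar_field R s).
Notation V := 'rV[K]_d.
Variable F : normedModType K.
Hypothesis q1 : 1 <= q.

(** Linearity in each entry of a list of length k. Lists, unlike functions on
    'I_k, can be filled from the left without casts. *)
Definition slot_linear (B : seq V -> F) : Prop :=
  forall r1 r2, (size r1 + size r2).+1 = k -> linear (fun u => B (r1 ++ u :: r2)).

Variables (B : seq V -> F) (xs : seq V) (M kappa : R).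
Hypothesis (Blin : slot_linear B) (cF : rcotype C (fun x : F => rnorm x `^ q)).
Hypothesis Bbound :
  forall r, size r = k -> (forall x, x \in r -> in_cube x) -> rnorm (B r) `^ q <= M.
Hypothesis kappaP : summing_on_cube s q C d kappa.
Hypothesis hxs : weakly_le 2 1 xs.

(** The sum of || B (x_1, ..., x_m, r) ||^q over all x_1, ..., x_m in xs, one slot
    after the other. *)
Fixpoint slot_sum (m : nat) (r : seq V) : R :=
  if m is m'.+1 then \sum_(x <- xs) slot_sum m' (x :: r) else rnorm (B r) `^ q.

Lemma slot_sum_ge0 m r : 0 <= slot_sum m r.
Proof.
by elim: m r => [|m IH] r /=; [exact: powR_ge0|exact: sumr_ge0].
Qed.

(** With one entry u left free, the sum over the filled slots is a sum of functions
    || B (..., u, ...) ||^q, each of them linear inside the norm. *)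
Lemma slot_sum_qconvex m r1 r2 : (m + (size r1 + size r2)).+1 = k ->
  qconvex q (fun u => slot_sum m (r1 ++ u :: r2)) /\
  rcotype C (fun u => slot_sum m (r1 ++ u :: r2)).
Proof.
elim: m r1 => [|m IH] r1 /= e.
  split.
    exact: (qconvex_comp (Blin e) (qconvex_rnorm F q1)).
  exact: (rcotype_comp (Blin e) cF).
have {}IH x := IH (x :: r1) (etrans (congr1 S (addnS _ _)) e).
split.
  by apply: (@qconvex_sum _ _ _ _ _ xs (fun x u => slot_sum m (x :: r1 ++ u :: r2))) => x; case: (IH x).
by apply: (@rcotype_sum _ _ _ _ _ xs (fun x u => slot_sum m (x :: r1 ++ u :: r2))) => x; case: (IH x).
Qed.

Lemma slot_sum_le m r : (m + size r)%N = k -> (forall x, x \in r -> in_cube x) ->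
  slot_sum m r <= kappa ^+ m * M.
Proof.
elim: m r => [|m IH] r /= e hr; first by rewrite mul1r Bbound.
have [h1 h2] := slot_sum_qconvex (m := m) (r1 := [::]) (r2 := r) e.
rewrite exprS -mulrA; apply: (kappaP h1 h2) => // x hx /=.
by apply: IH => [|y]; rewrite ?addnS // inE => /orP[/eqP->|/hr].
Qed.

Lemma slot_sum_diag m r x : x \in xs ->
  rnorm (B (nseq m x ++ r)) `^ q <= slot_sum m r.
Proof.
move=> hx; elim: m r => //= m IH r; rewrite (big_rem x) //=.
have <- : nseq m x ++ x :: r = x :: nseq m x ++ r.
  by elim: (m) => //= j ->.
apply: (le_trans (IH _)); rewrite lerDl sumr_ge0 // => y _; exact: slot_sum_ge0.
Qed.

(** The sum over the diagonal is part of the sum over all k-tuples, which filling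
    the slots bounds. *)
Lemma multilinear_summing : (0 < k)%N ->
  \sum_(x <- xs) rnorm (B (nseq k x)) `^ q <= kappa ^+ k * M.
Proof.
move=> k0; apply: le_trans (slot_sum_le (m := k) (r := [::]) (addn0 k) _) => //.
rewrite -(prednK k0) /= !big_seq; apply: ler_sum => x hx.
have -> : x :: nseq k.-1 x = nseq k.-1 x ++ [:: x].
  by elim: k.-1 => //= j <-.
exact: slot_sum_diag.
Qed.
End Multilinear.

(** * Polarization *)

Section Polarization.
Variables (K : numFieldType) (E F : lmodType K) (k : nat).
Variable A : ('I_k -> E) -> F.
Hypothesis Amult : multilinear A.

Definition set_slot (T : Type) (x : 'I_k -> T) (i : 'I_k) (u : T) : 'I_k -> T :=
  fun j => if j == i then u else x j.

Lemma multilinear_slot_sum (x : 'I_k -> E) i (I : finType) (c : I -> K) (u : I -> E) :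
  A (set_slot x i (\sum_j c j *: u j)) = \sum_j c j *: A (set_slot x i (u j)).
Proof.
have lin := Amult x i; rewrite -/(set_slot x i) in lin.
elim/big_rec2: _ => [|j y1 y2 _ <-]; last exact: lin.
have := GRing.zmod_morphism_linear lin 0 0.
by rewrite !subrr.
Qed.

(** Writing i at n into g, and remembering the old value, is an involution on the
    pairs (g, i). *)
Lemma sum_ffun_update (G : {ffun 'I_k -> 'I_k} -> F) (n : 'I_k) :
  (\sum_g G g) *+ k =
  \sum_(g : {ffun 'I_k -> 'I_k}) \sum_(i < k) G [ffun m => if m == n then i else g m].
Proof.
(* Swap the stored index with the value of g at n. *)
pose h (p : {ffun 'I_k -> 'I_k} * 'I_k) :=
  ([ffun m => if m == n then p.2 else p.1 m] : {ffun 'I_k -> 'I_k}, p.1 n).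
have hK : involutive h.
  move=> [g i]; rewrite /h /= ffunE eqxx; congr (_, _).
  by apply/ffunP => m; rewrite !ffunE; case: eqP => [->|].
rewrite pair_big /= (reindex_inj (inv_inj hK)) /=.
transitivity (\sum_(p : {ffun 'I_k -> 'I_k} * 'I_k) G p.1).
  rewrite -(pair_big xpredT xpredT (fun g _ => G g)) /= -sumrMnl.
  by apply: eq_bigr => g _; rewrite sumr_const card_ord.
apply: eq_bigr => -[g i] _ /=; congr G; apply/ffunP => m; rewrite !ffunE.
by case: eqP => [->|].
Qed.

(** Slots are expanded one after the other. The sum ranges over full maps g at each
    stage, so the slots not yet expanded contribute a factor k each; it is
    cancelled in characteristic zero. *)
Lemma multilinear_expand (x : 'I_k -> E) (c : 'I_k -> K) :
  A (fun=> \sum_i c i *: x i) =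
  \sum_(g : {ffun 'I_k -> 'I_k}) (\prod_m c (g m)) *: A (x \o g).
Proof.
set z := \sum_i _.
suff H n : (n <= k)%N -> forall y : 'I_k -> E,
    A (fun m => if (m < n)%N then z else y m) *+ k ^ (k - n) =
    \sum_(g : {ffun 'I_k -> 'I_k}) (\prod_(m < k | (m < n)%N) c (g m)) *:
      A (fun m => if (m < n)%N then x (g m) else y m).
  have := H k (leqnn k) (fun=> 0); rewrite subnn expn0 mulr1n.
  have -> : (fun m : 'I_k => if (m < k)%N then z else 0) = fun=> z.
    by apply/funext => m; rewrite ltn_ord.
  move=> ->; apply: eq_bigr => g _; congr (_ *: A _).
    by apply: eq_bigl => m; rewrite ltn_ord.
  by apply/funext => m; rewrite ltn_ord.
elim: n => [|n IH] nk y.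
  rewrite subn0 /= (eq_bigr (fun=> A y)) => [|g _].
    by rewrite sumr_const card_ffun card_ord.
  by rewrite big_pred0 // scale1r.
pose o := Ordinal nk.
have kk : (0 < k)%N := leq_ltn_trans (leq0n n) nk.
have IHn := IH (ltnW nk) (set_slot y o z).
have slotE (t : 'I_k -> E) u : (fun m : 'I_k => if (m < n)%N then t m else set_slot y o u m)
     = set_slot (fun m : 'I_k => if (m < n)%N then t m else y m) o u.
  apply/funext => m; rewrite /set_slot; case: eqP => [->|//].
  by rewrite /= ltnn.
have slotE' (t : 'I_k -> E) : (fun m : 'I_k => if (m < n.+1)%N then t m else y m)
     = set_slot (fun m : 'I_k => if (m < n)%N then t m else y m) o (t o).
  apply/funext => m; rewrite /set_slot ltnS leq_eqVlt -[m == n :> nat]/(m == o).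
  by case: eqP => [->|].
have kF (u v : F) : u *+ k = v *+ k -> u = v.
  move=> e; have k0 : k%:R != 0 :> K by rewrite pnatr_eq0 -lt0n.
  by apply: (scalerI k0); rewrite !scaler_nat.
apply: kF; rewrite (sum_ffun_update _ o).
rewrite -mulrnA -expnSr subnSK // slotE' -(slotE (fun=> z)) IHn.
apply: eq_bigr => g _.
rewrite (slotE (x \o g)) multilinear_slot_sum scaler_sumr; apply: eq_bigr => i _.
rewrite scalerA slotE'; congr (_ *: A _).
  rewrite [RHS](bigD1 o) /=; last exact: ltnSn.
  rewrite ffunE eqxx mulrC; congr (_ * _); apply: eq_big => m.
    by rewrite ltnS andbC -[m != o]/(m != n :> nat) ltn_neqAle.
  by move=> mn; rewrite ffunE; case: eqP mn => // ->; rewrite ltnn.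
apply/funext => m; rewrite /set_slot ffunE eqxx; case: eqP => // mo.
by rewrite ffunE; case: eqP.
Qed.

Definition sgn (e : {ffun 'I_k -> bool}) (i : 'I_k) : K := (-1) ^+ e i.

(** The sum factors over i; the factor of i is 1 + (-1)^(1 + #g^-1(i)), which
    vanishes when i is not a value of g. *)
Lemma sum_signs (g : {ffun 'I_k -> 'I_k}) :
  \sum_(e : {ffun 'I_k -> bool}) (\prod_i sgn e i) * (\prod_m sgn e (g m)) =
  if injectiveb g then 2 ^+ k else 0.
Proof.
transitivity (\prod_(i < k) \sum_(b : bool)
    ((-1) ^+ b * \prod_(m | g m == i) (-1) ^+ b) : K).
  rewrite bigA_distr_bigA /=; apply: eq_bigr => e _.
  rewrite [X in _ * X](partition_big g xpredT) //= -big_split /=; apply: eq_bigr => i _.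
  by congr (_ * _); apply: eq_big => m // /eqP ->.
case: ifP => [/injectiveP ginj|/injectiveP ginj].
  rewrite (eq_bigr (fun=> 2)) ?prodr_const ?card_ord // => i _.
  have gi m : (g m == i) = (m == invF ginj i).
    by rewrite -(inj_eq ginj m) f_invF.
  rewrite big_bool /= !(big_pred1 (invF ginj i)) // !expr1 expr0; ring.
have [i gi] : exists i, i \notin codom g.
  apply/existsP; rewrite -negb_forall; apply/negP => /forallP h; apply: ginj.
  apply/injectiveP/card_uniqP; rewrite size_map -cardE.
  by apply: eq_card => j; rewrite [RHS]inE; apply: h.
have gi0 m : (g m == i) = false by apply: contraNF gi => /eqP <-; apply: codom_f.
by rewrite (bigD1 i) //= big_bool /= !(eq_bigl _ _ gi0) !big_pred0_eq !mulr1 expr1 expr0 addNr mul0r.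
Qed.

Definition symmetrized (x : 'I_k -> E) : F := \sum_(p : 'S_k) A (fun m => x (p m)).

Lemma symmetrized_diag (u : E) : symmetrized (fun=> u) = A (fun=> u) *+ k`!.
Proof. by rewrite /symmetrized sumr_const card_Sn. Qed.

Lemma symmetrized_multilinear : multilinear symmetrized.
Proof.
move=> x i c u v; rewrite /symmetrized scaler_sumr -big_split /=.
apply: eq_bigr => p _.
have e (w : E) : (fun m => if p m == i then w else x (p m)) =
    (fun m => if m == (p^-1)%g i then w else x (p m)).
  by apply/funext => m; rewrite -(inj_eq (@perm_inj _ p) m) permKV.
by rewrite !e Amult.
Qed.

(** Expand the right side over maps g : 'I_k -> 'I_k; averaging over the signs keeps
    the permutations only. The k-linear map A need not be continuous, while the
    right side involves its diagonal alone. *)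
Lemma polarization (x : 'I_k -> E) :
  2 ^+ k *: symmetrized x = \sum_(e : {ffun 'I_k -> bool})
    (\prod_i sgn e i) *: A (fun=> \sum_i sgn e i *: x i).
Proof.
transitivity (\sum_(e : {ffun 'I_k -> bool}) \sum_(g : {ffun 'I_k -> 'I_k})
    ((\prod_i sgn e i) * \prod_m sgn e (g m)) *: A (x \o g)).
  rewrite exchange_big /= (bigID (fun g : {ffun _} => injectiveb g)) /= addrC.
  rewrite big1 ?add0r => [|g gi]; last first.
    by rewrite -scaler_suml sum_signs (negbTE gi) scale0r.
  rewrite (reindex (@pval _)) /=; last first.
    pose in_Sn := insubd (1%g : 'S_k).
    by exists in_Sn => /= g Ug; first apply: val_inj; apply: insubdK.
  rewrite scaler_sumr; apply: eq_big => [p|p _]; first by rewrite (valP p).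
  rewrite -scaler_suml sum_signs (valP p); congr (_ *: A _).
  by apply/funext => m; rewrite /= pvalE.
apply: eq_bigr => e _; rewrite multilinear_expand scaler_sumr.
by apply: eq_bigr => g _; rewrite scalerA.
Qed.

End Polarization.

(** * The Hahn-Banach theorem *)

Section HahnBanach.
Variables (R : realType) (s : scalar_kind) (E : normedModType (scalar_field R s)).
Notation K := (scalar_field R s).
Local Open Scope classical_set_scope.

(** Partial real-linear functionals are represented by their graphs, so that the
    union of a chain needs no gluing; domination makes the graph functional. *)
Definition rlinear_graph (G : set (E * R)) : Prop :=
  forall r x y a b, G (x, a) -> G (y, b) -> G (emb s r *: x + y, r * a + b).

Definition dominated_graph (c : R) (G : set (E * R)) : Prop :=
  forall x a, G (x, a) -> a <= c * rnorm x.

Lemma dominated_graph_fun c G x a b : rlinear_graph G -> dominated_graph c G ->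
  G (x, a) -> G (x, b) -> a = b.
Proof.
move=> lG dG; have le u v : G (x, u) -> G (x, v) -> v <= u.
  move=> hu hv; have := dG _ _ (lG (-1) _ _ _ _ hu hv).
  by rewrite embN emb1 scaleN1r addNr rnorm0 mulr0 mulN1r addrC subr_le0.
by move=> ha hb; apply/eqP; rewrite eq_le !le.
Qed.

Lemma rlinear_graph0 G x a : rlinear_graph G -> G (x, a) -> G (0, 0).
Proof.
move=> lG h; have := lG (-1) _ _ _ _ h h.
by rewrite embN emb1 scaleN1r addNr mulN1r addNr.
Qed.

Lemma rlinear_graphZ G r x a : rlinear_graph G -> G (x, a) ->
  G (emb s r *: x, r * a).
Proof.
by move=> lG h; have := lG r _ _ _ _ h (rlinear_graph0 lG h); rewrite !addr0.
Qed.

(** The value at x0 is the supremum of a - c ||x - x0|| over (x, a) in G; by the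
    triangle inequality it is at most every c ||y + x0|| - b. *)
Lemma dominated_graph_extend c G x0 : 0 <= c -> G !=set0 -> rlinear_graph G ->
  dominated_graph c G ->
  exists G', [/\ rlinear_graph G', dominated_graph c G', G `<=` G' &
                 exists a, G' (x0, a)].
Proof.
move=> c0 [[z e] hz] lG dG.
pose S := [set a.2 - c * rnorm (a.1 - x0) | a in G].
have ub y b : G (y, b) -> ubound S (c * rnorm (y + x0) - b).
  move=> hy _ [[x a] hx <-] /=; rewrite lerBlDr addrAC lerBrDr.
  have := dG _ _ (lG 1 _ _ _ _ hx hy); rewrite emb1 scale1r mul1r => /le_trans.
  apply; rewrite -mulrDr ler_wpM2l // addrC.
  have -> : y + x = (y + x0) + (x - x0) by rewrite addrACA subrr addr0.
  exact: rnormD.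
have S0 : S !=set0 by exists (e - c * rnorm (z - x0)), (z, e).
have hS : has_sup S by split=> //; exists (c * rnorm (z + x0) - e); apply: ub.
pose al := sup S.
have al_ge x a : G (x, a) -> a - c * rnorm (x - x0) <= al.
  by move=> h; apply: sup_upper_bound => //; exists (x, a).
have al_le y b : G (y, b) -> al <= c * rnorm (y + x0) - b.
  by move=> h; apply: ge_sup => //; apply: ub.
exists [set p | exists x a t, G (x, a) /\ p = (x + emb s t *: x0, a + t * al)].
split.
- move=> r _ _ _ _ [x [a [t [h [-> ->]]]]] [y [b [u [h' [-> ->]]]]].
  exists (emb s r *: x + y), (r * a + b), (r * t + u); split; first exact: lG.
  congr (_, _); last by ring.
  by rewrite scalerDr scalerA -embM addrACA embD scalerDl.
- move=> _ _ [x [a [t [h [-> ->]]]]].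
  have [t0|t0|->] := ltgtP t 0; last by rewrite emb0 scale0r mul0r !addr0 dG.
  + have r0 : 0 < - t by rewrite oppr_gt0.
    have := al_ge _ _ (rlinear_graphZ (- t)^-1 lG h).
    have -> : emb s (- t)^-1 *: x - x0 = emb s (- t)^-1 *: (x + emb s t *: x0).
      have mt : (- t)^-1 * t = -1 by rewrite invrN mulNr mulVf ?lt_eqF.
      by rewrite scalerDr scalerA -embM mt [emb s (-1)]embN emb1 scaleN1r.
    rewrite rnormZ cabs_emb gtr0_norm ?invr_gt0 //.
    move: (rnorm _) => N hN; have := ler_wpM2l (ltW r0) hN.
    have -> : - t * ((- t)^-1 * a - c * ((- t)^-1 * N)) = a - c * N.
      by field; rewrite lt_eqF.
    lra.
  + have := al_le _ _ (rlinear_graphZ t^-1 lG h).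
    have -> : emb s t^-1 *: x + x0 = emb s t^-1 *: (x + emb s t *: x0).
      by rewrite scalerDr scalerA -embM mulVf ?gt_eqF // emb1 scale1r.
    rewrite rnormZ cabs_emb gtr0_norm ?invr_gt0 //.
    move: (rnorm _) => N hN; have := ler_wpM2l (ltW t0) hN.
    have -> : t * (c * (t^-1 * N) - t^-1 * a) = c * N - a.
      by field; rewrite gt_eqF.
    lra.
- by move=> [x a] h; exists x, a, 0; rewrite emb0 scale0r mul0r !addr0.
- exists al, 0, 0, 1; split; first exact: rlinear_graph0 hz.
  by rewrite emb1 scale1r mul1r !add0r.
Qed.

(** Zorn's lemma is applied to the sets G with G0 `|` G a dominated graph: with this
    form the empty chain satisfies the condition as well. *)
Lemma real_hahn_banach c G0 : 0 <= c -> G0 !=set0 -> rlinear_graph G0 ->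
  dominated_graph c G0 ->
  exists g : E -> R, [/\ forall r x y, g (emb s r *: x + y) = r * g x + g y,
    forall x, g x <= c * rnorm x & forall x a, G0 (x, a) -> g x = a].
Proof.
move=> c0 G00 l0 d0.
pose P (G : set (E * R)) := rlinear_graph (G0 `|` G) /\ dominated_graph c (G0 `|` G).
have [|G [[lG dG] maxG]] := @Zorn_bigcup _ P.
  move=> FF FP tot.
  have pick p p' : (G0 `|` \bigcup_(A in FF) A) p -> (G0 `|` \bigcup_(A in FF) A) p' ->
     (G0 p /\ G0 p') \/ exists2 A, FF A & (G0 `|` A) p /\ (G0 `|` A) p'.
    case=> [h|[A FA h]] [h'|[A' FA' h']]; first by left.
    - by right; exists A' => //; split; [left|right].
    - by right; exists A => //; split; [right|left].
    - have [AA'|A'A] := tot _ _ FA FA'.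
        by right; exists A' => //; split; right => //; apply: AA'.
      by right; exists A => //; split; right => //; apply: A'A.
  split.
    move=> r x y a b hx hy; have [[h1 h2]|[A FA [h1 h2]]] := pick _ _ hx hy.
      by left; apply: l0.
    have [lA _] := FP _ FA; have [h|h] := lA r _ _ _ _ h1 h2; first by left.
    by right; exists A.
  move=> x a h; have [[h1 _]|[A FA [h1 _]]] := pick _ _ h h; first exact: d0.
  by have [_ dA] := FP _ FA; apply: dA.
have G0G : (G0 `|` G) !=set0 by case: G00 => p hp; exists p; left.
have total x : exists a, (G0 `|` G) (x, a).
  have [G' [lG' dG' sub [a ha]]] := dominated_graph_extend x c0 G0G lG dG.
  exists a; apply: contrapT => na; apply: (maxG G').
    split; first by move=> p hp; apply: sub; right.
    by move=> sub'; apply: na; right; apply: sub'.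
  have e : G0 `|` G' = G'.
    by apply/seteqP; split=> [p [hp|//]|p hp]; [apply: sub; left|right].
  by rewrite /P e.
pose g x := projT1 (cid (total x)).
have gP x : (G0 `|` G) (x, g x) by rewrite /g; case: cid.
exists g; split=> [r x y|x|x a h].
- by apply: (dominated_graph_fun lG dG (gP _)); apply: lG.
- exact: dG (gP x).
- by apply: (dominated_graph_fun lG dG (gP x)); left.
Qed.
End HahnBanach.

Lemma scalar_re_linear (R : realType) (s : scalar_kind) (r : R) (z w : scalar_field R s) :
  scalar_re (emb s r * z + w) = r * scalar_re z + scalar_re w.
Proof.
by case: s z w => [z w //|[a b] [c d]] /=; rewrite mul0r subr0.
Qed.

Lemma scalar_re_le (R : realType) (s : scalar_kind) (z : scalar_field R s) :
  scalar_re z <= cabs z.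
Proof.
rewrite /cabs; case: s z => [z|[a b]] /=; first exact: ler_norm.
apply: (le_trans (ler_norm _)); rewrite -sqrtr_sqr ler_wsqrtr //.
by rewrite lerDl sqr_ge0.
Qed.

Lemma unimodular (R : realType) (s : scalar_kind) (z : scalar_field R s) :
  exists2 u, cabs u = 1 & u * z = emb s (cabs z).
Proof.
have [->|z0] := eqVneq z 0.
  by exists 1; rewrite ?mulr0 ?cabs0 ?emb0 // -(emb1 R s) cabs_emb normr1.
exists (emb s (cabs z) / z); last by rewrite divfK.
rewrite cabsM cabs_emb ger0_norm ?cabs_ge0 //.
apply: (@emb_inj R s); rewrite embM !emb_cabs emb1 normfV divff //.
by rewrite normr_eq0.
Qed.

(** In the complex case phi x = g x - i g (i x). *)
Lemma linear_of_real_part (R : realType) (s : scalar_kind)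
    (E : lmodType (scalar_field R s)) (g : E -> R) :
  (forall r x y, g (emb s r *: x + y) = r * g x + g y) ->
  exists2 phi : E -> (scalar_field R s)^o, linear phi &
    forall x, scalar_re (phi x) = g x.
Proof.
case: s E g => E g /= gl; first by exists g.
pose i : R[i] := Complex 0 1.
have g0 : g 0 = 0.
  have := gl (-1) 0 0; rewrite scaler0 addr0 mulN1r => h; lra.
have gD x y : g (x + y) = g x + g y by have := gl 1 x y; rewrite scale1r mul1r.
have gZ r x : g (real_complex R r *: x) = r * g x.
  by have := gl r x 0; rewrite addr0 g0 addr0.
exists (fun x => Complex (g x) (- g (i *: x))) => // -[a b] x y.
have e : Complex a b = real_complex R a + real_complex R b * i.
  by simpc.
have cx : g (Complex a b *: x) = a * g x + b * g (i *: x).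
  by rewrite e scalerDl gD gZ -scalerA gZ.
have ci : g (i *: (Complex a b *: x)) = a * g (i *: x) - b * g x.
  have e' : i * Complex a b = real_complex R a * i + real_complex R (- b).
    by apply/eqP; rewrite eq_complex /=; apply/andP; split; apply/eqP; ring.
  by rewrite scalerA e' scalerDl gD gZ -scalerA gZ mulNr.
rewrite scalerDr !gD ci cx.
by apply/eqP; rewrite eq_complex /=; apply/andP; split; apply/eqP; ring.
Qed.

(** A linear functional and its norm are determined by its real part, because
    u phi(x) = |phi x| for some u of modulus 1. *)
Lemma hahn_banach (R : realType) (s : scalar_kind)
    (E : normedModType (scalar_field R s)) (H : set E) (psi : E -> scalar_field R s)
    (c : R) : 0 <= c -> H 0 ->
  (forall r x y, H x -> H y -> H (r *: x + y)) ->
  (forall r x y, H x -> H y -> psi (r *: x + y) = r * psi x + psi y) ->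
  (forall x, H x -> cabs (psi x) <= c * rnorm x) ->
  exists phi : {linear E -> (scalar_field R s)^o},
    [/\ forall x, H x -> phi x = psi x, forall x, cabs (phi x) <= c * rnorm x &
        continuous phi].
Proof.
move=> c0 H0 Hl psil psib.
pose G0 : set (E * R) := [set p | H p.1 /\ p.2 = scalar_re (psi p.1)]%classic.
have [||| g [gl gb gG]] := @real_hahn_banach R s E c G0 c0.
- by exists (0, scalar_re (psi 0)).
- move=> r x y a b [/= hx ->] [/= hy ->]; split=> /=; first exact: Hl.
  by rewrite psil // scalar_re_linear.
- by move=> x a [/= hx ->]; apply: le_trans (psib x hx); apply: scalar_re_le.
have [phi lphi phig] := linear_of_real_part gl.
pose L : {linear E -> (scalar_field R s)^o} :=
  HB.pack phi (GRing.isLinear.Build _ _ _ _ phi lphi).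
have Lre x : scalar_re (L x) = g x by apply: phig.
have Lle x : cabs (L x) <= c * rnorm x.
  have [u u1 ux] := unimodular (L x).
  rewrite -[leLHS](scalar_reK s) -ux -[u * L x]/(u *: L x) -linearZ Lre.
  by apply: (le_trans (gb _)); rewrite rnormZ u1 mul1r.
exists L; split=> // [x hx|].
  have [u u1 ux] := unimodular (psi x - L x).
  have : cabs (psi x - L x) = 0.
    rewrite -[LHS](scalar_reK s) -ux mulrBr.
    have H' : H (u *: x) by rewrite -[_ *: _]addr0; apply: Hl.
    have psi0 : psi 0 = 0.
      have := psil (-1) 0 0 H0 H0; rewrite scaler0 addr0 mulN1r addNr => {1}->.
      by [].
    have -> : u * psi x = psi (u *: x).
      by rewrite -[in RHS](addr0 (_ *: _)) psil // psi0 addr0.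
    rewrite -[u * L x]/(u *: L x) -linearZ.
    have := scalar_re_linear (-1) (L (u *: x)) (psi (u *: x)).
    rewrite embN emb1 !mulN1r addrC => ->.
    by rewrite Lre (gG _ (scalar_re (psi (u *: x)))) ?addNr.
  move=> h; apply/eqP; rewrite eq_sym -subr_eq0 -normr_eq0 -emb_cabs h.
  by rewrite emb0.
apply: bounded_linear_continuous; apply/linear_boundedP.
near=> r => x; rewrite -[`|L x|]emb_cabs.
apply: (@le_trans _ _ (emb s c * `|x|)).
  by rewrite -emb_rnorm -embM ler_emb.
rewrite ler_wpM2r //; near: r; apply: nbhs_pinfty_ge.
by rewrite ger0_real // emb_ge0.
Unshelve. all: by end_near.
Qed.

(** * Rademacher averages as averages over signs *)

Section Rademacher.
Variable R : realType.
Local Open Scope classical_set_scope.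

(** The point c has measure zero. *)
Lemma ge0_integral_split (a c b : R) (h : R -> R) : a < c -> c < b ->
  (forall t, 0 <= h t) ->
  measurable_fun (`]a, c[ : set R) h -> measurable_fun (`]c, b[ : set R) h ->
  measurable_fun (`]a, b[ : set R) h /\
  (\int[lebesgue_measure]_(t in `]a, b[) (h t)%:E =
   \int[lebesgue_measure]_(t in `]a, c[) (h t)%:E +
   \int[lebesgue_measure]_(t in `]c, b[) (h t)%:E)%E.
Proof.
move=> ac cb h0 mac mcb.
have mac' : measurable_fun (`]a, c] : set R) h by apply/measurable_fun_itv_bndo_bndcP.
have U : `]a, b[ = `]a, c] `|` `]c, b[ :> set R.
  by rewrite -itv_bndbnd_setU // bnd_simp // ltW.
have mU : measurable_fun (`]a, b[ : set R) h.
  by rewrite U; apply/measurable_funU.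
split=> //; rewrite U ge0_integral_setU //=.
- congr (_ + _)%E; rewrite integral_itv_bndoo //.
  exact/measurable_EFinP.
- by apply/measurable_EFinP; rewrite -U.
- by move=> t _; rewrite lee_fin.
- apply/disj_setPS => t [] /=; rewrite !in_itv /= => /andP[_ tc] /andP[ct _].
  by have := lt_le_trans ct tc; rewrite ltxx.
Qed.

Definition dyadic (l m : nat) : set R := `]m%:R / 2 ^+ l, m.+1%:R / 2 ^+ l[.

Lemma dyadic_split l m :
  [/\ m%:R / 2 ^+ l = (m.*2)%:R / 2 ^+ l.+1 :> R,
      m.+1%:R / 2 ^+ l = (m.*2).+2%:R / 2 ^+ l.+1 :> R,
      (m.*2)%:R / 2 ^+ l.+1 < (m.*2).+1%:R / 2 ^+ l.+1 :> R &
      (m.*2).+1%:R / 2 ^+ l.+1 < (m.*2).+2%:R / 2 ^+ l.+1 :> R].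
Proof.
have e0 : 2 ^+ l != 0 :> R by rewrite expf_neq0.
have i0 : 0 < (2 ^+ l.+1)^-1 :> R by rewrite invr_gt0 exprn_gt0.
split; rewrite ?ltr_pM2r ?ltr_nat //; rewrite exprS -?doubleS -muln2 natrM.
  by field.
by field.
Qed.

Lemma sgz_sin (n : nat) (u : R) : n%:R < u < n.+1%:R ->
  sgz (sin (u * pi)) = (-1) ^+ n.
Proof.
elim: n u => [|n IH] u /andP[u0 u1].
  rewrite expr0 gtr0_sgz // sin_gt0_pi // mulr_gt0 ?pi_gt0 //=.
  by rewrite -ltr_pdivlMr ?pi_gt0 // divff ?gt_eqF ?pi_gt0.
have -> : u * pi = (u - 1) * pi + pi by ring.
rewrite sinDpi sgzN IH ?exprS ?mulN1r //.
by rewrite ltrBrDr ltrBlDr !natr1 u0.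
Qed.

(** On the m-th dyadic interval of order l, 2^l t lies between m and m + 1. *)
Lemma rademacher_dyadic l m t : dyadic l m t -> rademacher l t = (-1) ^+ m :> int.
Proof.
rewrite /dyadic /= in_itv /= => /andP[h1 h2].
have e0 : 0 < 2 ^+ l :> R by rewrite exprn_gt0.
rewrite /rademacher mulrAC; apply: sgz_sin.
by rewrite mulrC -ltr_pdivrMr // h1 -ltr_pdivlMr.
Qed.

Section Average.
Variables (F : zmodType) (G : F -> R).
Hypothesis G0 : forall y, 0 <= G y.

Fixpoint rademacher_sum (a : F) (xs : seq F) (l : nat) (t : R) : F :=
  if xs is x :: xs' then rademacher_sum (a + x *~ rademacher l.+1 t) xs' l.+1 t else a.

(** The two halves of a dyadic interval of order l are dyadic intervals of order
    l + 1, on which the first remaining Rademacher function is 1 and -1. *)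
Lemma integral_rademacher_sum a xs l m :
  measurable_fun (dyadic l m) (fun t => G (rademacher_sum a xs l t)) /\
  (\int[lebesgue_measure]_(t in dyadic l m) (G (rademacher_sum a xs l t))%:E =
   ((\sum_(y <- signed_sums a xs) G y) / 2 ^+ (l + size xs))%:E)%E.
Proof.
elim: xs a l m => [|x xs IH] a l m /=.
  split; first exact: measurable_cst.
  rewrite (integral_cst _ _ (G a)%:E); last exact: measurable_itv.
  have i0 : 0 < (2 ^+ l)^-1 :> R by rewrite invr_gt0 exprn_gt0.
  have mu : lebesgue_measure (dyadic l m) = ((2 ^+ l)^-1)%:E.
    rewrite /dyadic lebesgue_measure_itv /= lte_fin ltr_pM2r // ltr_nat ltnSn -EFinB.
    by rewrite -mulrBl -natr1 addrAC subrr add0r mul1r.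
  by rewrite big_seq1 addn0 EFinM -mu.
have [e1 e2 lt1 lt2] := dyadic_split l m.
have [ml il] := IH (a + x) l.+1 (m.*2).
have [mr ir] := IH (a - x) l.+1 (m.*2).+1.
pose h t := G (rademacher_sum (a + x *~ rademacher l.+1 t) xs l.+1 t).
have hl : {in dyadic l.+1 m.*2, h =1 fun t => G (rademacher_sum (a + x) xs l.+1 t)}.
  move=> t; rewrite inE => /rademacher_dyadic; rewrite /h => ->.
  by rewrite -signr_odd odd_double mulr1z.
have hr : {in dyadic l.+1 (m.*2).+1, h =1 fun t => G (rademacher_sum (a - x) xs l.+1 t)}.
  move=> t; rewrite inE => /rademacher_dyadic; rewrite /h => ->.
  by rewrite -signr_odd /= odd_double mulrN1z.
have mhl := eq_measurable_fun _ (fun t ht => esym (hl t ht)) ml.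
have mhr := eq_measurable_fun _ (fun t ht => esym (hr t ht)) mr.
have [mh ih] := ge0_integral_split lt1 lt2 (fun t => G0 _) mhl mhr.
have il' : (\int[lebesgue_measure]_(t in dyadic l.+1 m.*2) (h t)%:E =
    ((\sum_(y <- signed_sums (a + x) xs) G y) / 2 ^+ (l.+1 + size xs))%:E)%E.
  by rewrite -il; apply: eq_integral => t ht; rewrite hl.
have ir' : (\int[lebesgue_measure]_(t in dyadic l.+1 (m.*2).+1) (h t)%:E =
    ((\sum_(y <- signed_sums (a - x) xs) G y) / 2 ^+ (l.+1 + size xs))%:E)%E.
  by rewrite -ir; apply: eq_integral => t ht; rewrite hr.
rewrite {1 2}/dyadic e1 e2; split=> //.
rewrite ih; apply: (etrans (congr2 (fun u v => u + v)%E il' ir')).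
by rewrite -EFinD big_cat /= mulrDl addSnnS.
Qed.

Lemma rademacher_sumE a (xs : seq F) l t :
  rademacher_sum a xs l t =
  a + \sum_(j < size xs) nth 0 xs j *~ rademacher (l + j).+1 t.
Proof.
elim: xs a l => [|x xs IH] a l /=; first by rewrite big_ord0 addr0.
rewrite IH big_ord_recl /= addn0 addrA; congr (_ + _); apply: eq_bigr => j _.
by rewrite /bump /= addSnnS.
Qed.
End Average.
End Rademacher.

(** The integral over [0, 1] is an average over all signs. *)
Lemma rademacher_average_signed_sums (R : realType) (s : scalar_kind)
    (F : normedModType (scalar_field R s)) (xs : seq F) :
  rademacher_average (fun j : 'I_(size xs) => nth 0 xs j) ^+ 2 =
  (\sum_(y <- signed_sums 0 xs) rnorm y ^+ 2) / 2 ^+ size xs.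
Proof.
have G0 (y : F) : 0 <= rnorm y ^+ 2 by rewrite sqr_ge0.
have [mI eI] := integral_rademacher_sum G0 0 xs 0 0.
rewrite sqr_sqrtr; last by apply: Rintegral_ge0.
rewrite /Rintegral; move: mI eI; rewrite /dyadic expr0 !divr1 add0n => mI eI.
have e t : rnorm (\sum_(j < size xs) nth 0 xs j *~ rademacher j.+1 t) ^+ 2 =
           rnorm (rademacher_sum 0 xs 0 t) ^+ 2.
  by rewrite rademacher_sumE add0r.
under eq_integral do rewrite e.
rewrite integral_itv_bndoo; last exact/measurable_EFinP.
by rewrite eI.
Qed.

(** This is the convexity of ||.||^p in the mean of real scalars. *)
Lemma powR_mean (R : realType) (p : R) (a : seq R) : 1 <= p -> a != [::] ->
  all (fun x => 0 <= x) a ->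
  (size a)%:R * ((size a)%:R^-1 * \sum_(x <- a) x) `^ p <= \sum_(x <- a) x `^ p.
Proof.
move=> p1 a0 /allP apos.
pose F : normedModType (scalar_field R RealScalars) := (scalar_field R RealScalars)^o.
have := qconvex_mean (qconvex_rnorm F p1) (xs := a) a0.
rewrite rnormZ cabs_emb ger0_norm ?invr_ge0 //.
have rn (x : R) : 0 <= x -> rnorm (x : F) = x by move=> x0; apply: ger0_norm.
rewrite rn; last by rewrite big_seq sumr_ge0.
have e : \sum_(x <- a) rnorm (x : F) `^ p = \sum_(x <- a) x `^ p.
  rewrite big_seq [RHS]big_seq; apply: eq_bigr => x /apos x0.
  by rewrite rn.
by rewrite e.
Qed.

(** Raise the cotype inequality to the power q; Jensen's inequality for the power
    q / 2 >= 1 replaces the quadratic mean by the mean of q-th powers. *)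
Lemma rcotype_of_cotype (R : realType) (s : scalar_kind) (q : R)
    (F : normedModType (scalar_field R s)) : 2 <= q -> has_cotype F q%:E ->
  exists2 C, 0 <= C & rcotype C (fun x : F => rnorm x `^ q).
Proof.
move=> q2 [C C0 hC]; exists (C `^ q); first exact: powR_ge0.
have q0 : 0 < q by lra.
move=> xs; have := hC _ (fun j : 'I_(size xs) => nth 0 xs j).
rewrite /lq_norm; set S := \sum_(j < _) _; set A := rademacher_average _.
have eS : S = \sum_(x <- xs) rnorm x `^ q by rewrite (big_nth 0) big_mkord.
have S0 : 0 <= S by rewrite sumr_ge0 // => i _; rewrite powR_ge0.
have A0 : 0 <= A by apply: sqrtr_ge0.
move=> h.
have h1 : S <= C `^ q * A `^ q.
  rewrite -powRM //; apply: le_trans (ge0_ler_powR (ltW q0) _ _ h).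
  - by rewrite -powRrM mulVf ?gt_eqF // powRr1.
  - by rewrite nnegrE powR_ge0.
  - by rewrite nnegrE mulr_ge0.
set N := 2 ^+ size xs; have N0 : 0 < N :> R by rewrite exprn_gt0.
rewrite -eS; apply: (le_trans (ler_wpM2l (ltW N0) h1)).
rewrite mulrCA ler_wpM2l ?powR_ge0 //.
have -> : A `^ q = (A ^+ 2) `^ (q / 2).
  by rewrite -powR_mulrn // -powRrM mulrC divfK.
rewrite rademacher_average_signed_sums -/N.
pose sq := [seq rnorm y ^+ 2 | y <- signed_sums 0 xs].
have szq : (size sq)%:R = N by rewrite size_map size_signed_sums natrX.
have sq0 : sq != [::].
  by rewrite -size_eq0 size_map size_signed_sums -lt0n expn_gt0.
have sqpos : all (fun x => 0 <= x) sq.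
  by apply/allP => _ /mapP[y _ ->]; rewrite sqr_ge0.
have hq : 1 <= q / 2 by lra.
have := powR_mean hq sq0 sqpos; rewrite szq !big_map [_ / N]mulrC => /le_trans.
apply.
apply: ler_sum => y _; rewrite -powR_mulrn ?rnorm_ge0 // -powRrM mulrC divfK //.
Qed.


(** * Factoring finite families through the cube *)

Lemma span_finite (K : fieldType) (E : lmodType K) (xs : seq E) :
  exists (m : nat) (b : 'I_m -> E),
    (forall c : 'I_m -> K, \sum_(i < m) c i *: b i = 0 -> forall i, c i = 0) /\
    forall x, x \in xs -> exists c : 'I_m -> K, x = \sum_(i < m) c i *: b i.
Proof.
elim: xs => [|y xs [m [b [free gen]]]].
  by exists 0%N, (fun=> 0); split=> [c _ []|].
have [[c yc]|yn] := pselect (exists c : 'I_m -> K, y = \sum_(i < m) c i *: b i).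
  exists m, b; split=> // x; rewrite inE => /orP[/eqP->|/gen //].
  by exists c.
exists m.+1, (fun i => if unlift ord0 i is Some j then b j else y).
have split (c : 'I_m.+1 -> K) : \sum_(i < m.+1) c i *: (if unlift ord0 i is Some j then b j else y)
    = c ord0 *: y + \sum_(i < m) c (lift ord0 i) *: b i.
  rewrite big_ord_recl unlift_none; congr (_ + _); apply: eq_bigr => i _.
  by rewrite liftK.
split=> [c|x].
  rewrite split => h.
  have c0 : c ord0 = 0.
    apply: contrapT => /eqP c0; apply: yn.
    exists (fun i => - (c ord0)^-1 * c (lift ord0 i)).
    have /(congr1 (fun u => (c ord0)^-1 *: u)) := h.
    rewrite scalerDr scalerA mulVf // scale1r scaler0 scaler_sumr => /eqP.
    rewrite addr_eq0 => /eqP ->; rewrite -sumrN; apply: eq_bigr => i _.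
    by rewrite scalerA mulNr scaleNr.
  move: h; rewrite c0 scale0r add0r => /free hc i.
  by case: (unliftP ord0 i) => [j ->|->].
rewrite inE => /orP[/eqP->|/gen[c ->]].
  exists (fun i => if unlift ord0 i is Some j then 0 else 1).
  rewrite split unlift_none scale1r big1 ?addr0 // => i _.
  by rewrite liftK scale0r.
exists (fun i => if unlift ord0 i is Some j then c j else 0).
rewrite split unlift_none scale0r add0r; apply: eq_bigr => i _.
by rewrite liftK.
Qed.

Lemma cabs_le_rnorm (R : realType) (s : scalar_kind) (n : nat)
    (y : 'rV[scalar_field R s]_n) i : cabs (y 0 i) <= rnorm y.
Proof.
rewrite -(ler_emb s) emb_cabs emb_rnorm [leRHS]/Num.Def.normr /= mx_normE.
rewrite -[leLHS]nngE num_le.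
exact: (@le_bigmax _ _ _ _ (fun j : 'I_1 * 'I_n => `|y j.1 j.2|%:nng) (0, i)).
Qed.

Lemma in_cube_rnorm (R : realType) (s : scalar_kind) (n : nat)
    (y : 'rV[scalar_field R s]_n) : in_cube y -> rnorm y <= 1.
Proof.
move=> hy; rewrite -(ler_emb s) emb_rnorm emb1 [leLHS]/Num.Def.normr /=.
have [->|/mx_norm_neq0[[i j] ->] /=] := eqVneq (mx_norm y) 0; first exact: ler01.
by rewrite -emb_cabs -(emb1 R s) ler_emb ord1.
Qed.

Section Opnorm.
Variables (R : realType) (s : scalar_kind).
Notation K := (scalar_field R s).
Variables (E F : normedModType K) (D : set E) (v : E -> F).
Hypothesis Dscale : forall c x, D x -> D (c *: x).
Hypothesis vscale : forall c x, D x -> v (c *: x) = c *: v x.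

Lemma opnorm_ub x : D x -> rnorm x <= 1 -> ((rnorm (v x))%:E <= opnorm D v)%E.
Proof. by move=> Dx x1; apply: ereal_sup_ubound; exists x. Qed.

(** The product of the two norms in the definition of an l_oo-space is taken in the
    extended reals, where 0 times oo is 0; positivity excludes infinite factors. *)
Lemma opnorm_gt0 x : D x -> v x != 0 -> (0 < opnorm D v)%E.
Proof.
move=> Dx vx.
have v0 : v 0 = 0 by have := vscale 0 Dx; rewrite !scale0r.
have x0 : 0 < rnorm x.
  rewrite lt_neqAle rnorm_ge0 andbT eq_sym; apply: contra vx => /eqP/rnorm_eq0 ->.
  by rewrite v0.
have ix0 : 0 < (rnorm x)^-1 by rewrite invr_gt0.
apply: lt_le_trans (opnorm_ub (Dscale (emb s (rnorm x)^-1) Dx) _).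
  rewrite vscale // rnormZ cabs_emb gtr0_norm // lte_fin mulr_gt0 //.
  rewrite lt_neqAle rnorm_ge0 andbT eq_sym.
  by apply: contra vx => /eqP/rnorm_eq0 ->.
by rewrite rnormZ cabs_emb gtr0_norm // mulVf ?gt_eqF.
Qed.

Lemma opnorm_le (c : R) x : opnorm D v = c%:E -> D x -> rnorm (v x) <= c * rnorm x.
Proof.
move=> hc Dx.
have v0 : v 0 = 0 by have := vscale 0 Dx; rewrite !scale0r.
have := rnorm_ge0 x; rewrite le_eqVlt => /orP[/eqP x0|x0].
  by rewrite (rnorm_eq0 (esym x0)) v0 !rnorm0 mulr0.
have ix0 : 0 < (rnorm x)^-1 by rewrite invr_gt0.
have := opnorm_ub (Dscale (emb s (rnorm x)^-1) Dx).
rewrite vscale // !rnormZ cabs_emb gtr0_norm // mulVf ?gt_eqF // hc lee_fin.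
by move=> /(_ (lexx _)); rewrite ler_pdivrMl // mulrC.
Qed.

End Opnorm.

(** The coordinates x |-> V^-1 (v x)(i), V the norm of v, have norm at most 1 on H,
    and extend to X by Hahn-Banach; so the weak 2-norm of xs bounds the sums
    sum_x |(v x)(i)|^2. Rescaling v by (V eta)^-1 normalizes them. *)
Lemma Linfty_factor (R : realType) (s : scalar_kind)
    (X : normedModType (scalar_field R s)) (lambda eta : R) (xs : seq X) :
  0 < lambda -> 0 < eta -> Linfty_space X lambda ->
  (forall phi : {linear X -> (scalar_field R s)^o}, continuous phi ->
    (opnorm [set: X]%classic phi <= 1%:E)%E ->
    \sum_(x <- xs) cabs (phi x) ^+ 2 <= eta ^+ 2) ->
  exists (d : nat) (w : 'rV[scalar_field R s]_d -> X) (zs : seq 'rV[scalar_field R s]_d),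
    [/\ linear w, xs = [seq w z | z <- zs],
        forall z, in_cube z -> rnorm (w z) <= lambda * eta & weakly_le 2 1 zs].
Proof.
move=> l0 eta0 hX hweak.
have [m [b [bfree bgen]]] := span_finite xs.
pose G : set X := [set x | exists c : 'I_m -> scalar_field R s, x = \sum_(i < m) c i *: b i]%classic.
have [n [H [[b' _ HE] GH [v [w [vlin wv Hw vw vwl]]]]]] : exists n (H : set X), 
    [/\ subspace_of_dim n H, (G `<=` H)%classic &
      exists (v : X -> 'rV[scalar_field R s]_n)
             (w : 'rV[scalar_field R s]_n -> X),
        [/\ (forall (c : scalar_field R s) (x y : X), H x -> H y ->
               v (c *: x + y) = c *: v x + v y),
            (forall x, H x -> w (v x) = x),
            (forall y, H (w y)),
            (forall y, v (w y) = y) &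
            (opnorm H v * opnorm [set: 'rV_n]%classic w < lambda%:E)%E]].
  by apply: (hX m); exists b.
have Hlin c x y : H x -> H y -> H (c *: x + y).
  rewrite HE => -[cx ->] [cy ->]; exists (fun i => c * cx i + cy i).
  rewrite scaler_sumr -big_split /=; apply: eq_bigr => i _.
  by rewrite scalerDl scalerA.
have H0 : H 0 by rewrite HE; exists (fun=> 0); rewrite big1 // => i _; rewrite scale0r.
have HZ c x : H x -> H (c *: x) by move=> hx; rewrite -[_ *: _]addr0; apply: Hlin.
have v0 : v 0 = 0.
  by have := vlin (-1) 0 0 H0 H0; rewrite scaler0 addr0 scaleN1r addNr.
have vZ c x : H x -> v (c *: x) = c *: v x.
  by move=> hx; rewrite -[c *: x]addr0 vlin // v0 addr0.
have wlin : linear w.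
  by move=> c y z; rewrite -(wv (c *: w y + w z)) ?vlin ?vw //; apply: Hlin.
have wZ c y : w (c *: y) = c *: w y by apply: (GRing.scalable_linear wlin).
have Hxs x : x \in xs -> H x by move=> /bgen hx; apply: GH.
have [V [W [V0 W0 vV wW VW]]] : exists V W : R, [/\ 0 < V, 0 <= W,
    forall x, H x -> rnorm (v x) <= V * rnorm x,
    forall y, rnorm (w y) <= W * rnorm y & V * W <= lambda].
  case: n b' HE v w vlin wv Hw vw vwl v0 vZ wlin wZ => [|n] b' HE v w vlin wv Hw vw vwl v0 vZ wlin wZ.
    exists 1, 0; split.
    - exact: ltr01.
    - by [].
    - move=> x hx; have -> : v x = 0 by apply/rowP => -[].
      by rewrite rnorm0 mul1r rnorm_ge0.
    - move=> y; have -> : y = 0 by apply/rowP => -[].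
      have -> : w 0 = 0 by have := wZ 0 0; rewrite !scale0r.
      by rewrite rnorm0 mul0r.
    - by rewrite mulr0 ltW.
  (* In positive dimension both norms are positive, hence finite. *)
  pose e : 'rV[scalar_field R s]_n.+1 := const_mx 1.
  have e0 : e != 0.
    by apply/eqP => /rowP/(_ ord0); rewrite !mxE => /eqP; rewrite oner_eq0.
  have pV : (0 < opnorm H v)%E.
    by apply: (opnorm_gt0 HZ vZ (Hw e)); rewrite vw.
  have pW : (0 < opnorm [set: 'rV_n.+1]%classic w)%E.
    apply: (@opnorm_gt0 _ _ _ _ _ _ _ _ e) => //.
    by apply: contra_neq e0 => we; rewrite -(vw e) we v0.
  have [V hV] : exists V, opnorm H v = V%:E.
    case: (opnorm H v) pV vwl => [r _ _|_|//]; first by exists r.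
    by rewrite gt0_mulye.
  have [W hW] : exists W, opnorm [set: 'rV_n.+1]%classic w = W%:E.
    case: (opnorm setT w) pW vwl => [r _ _|_|//]; first by exists r.
    by rewrite gt0_muley.
  rewrite hV hW -EFinM !lte_fin in pV pW vwl.
  exists V, W; split=> //; [exact: ltW| | |exact: ltW].
  - by move=> x hx; apply: (opnorm_le HZ vZ hV).
  - by move=> y; apply: (opnorm_le (D := setT) _ _ hW).
pose c := V * eta; have c0 : 0 < c by rewrite mulr_gt0.
exists n, (fun z => w (emb s c *: z)), [seq emb s c^-1 *: v x | x <- xs]; split.
- by move=> k y z; rewrite scalerDr scalerA mulrC -scalerA wlin.
- rewrite -map_comp -[LHS]map_id; apply/eq_in_map => x /Hxs hx /=.
  by rewrite scalerA -embM divff ?gt_eqF // emb1 scale1r wv.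
- move=> z /in_cube_rnorm z1; apply: (le_trans (wW _)).
  rewrite rnormZ cabs_emb gtr0_norm // /c.
  apply: (@le_trans _ _ (V * W * eta)); last by rewrite ler_wpM2r // ltW.
  apply: (@le_trans _ _ (V * W * eta * rnorm z)).
    by rewrite le_eqVlt; apply/orP; left; apply/eqP; ring.
  by rewrite ler_piMr // !mulr_ge0 // ltW.
- move=> i; rewrite big_map.
  pose psi x : scalar_field R s := emb s V^-1 * v x 0 i.
  have [phi [phiE phib phic]] : exists phi : {linear X -> (scalar_field R s)^o},
    [/\ forall x, H x -> phi x = psi x, forall x, cabs (phi x) <= 1 * rnorm x &
        continuous phi].
    apply: (hahn_banach (H := H)) => //.
      by move=> r x y hx hy; rewrite /psi vlin // !mxE mulrDr mulrCA.
    move=> x hx; rewrite /psi cabsM cabs_emb gtr0_norm ?invr_gt0 // mul1r.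
    rewrite ler_pdivrMl //; apply: le_trans (vV x hx); exact: cabs_le_rnorm.
  have := hweak phi phic.
  have o1 : (opnorm [set: X]%classic phi <= 1%:E)%E.
    apply: ge_ereal_sup => _ [x [_ /= x1] <-]; rewrite lee_fin.
    by apply: (le_trans (phib x)); rewrite mul1r.
  move=> /(_ o1) hw; rewrite -(ler_pM2l (exprn_gt0 2 eta0)) mulr1.
  apply: le_trans hw; rewrite mulr_sumr big_seq [leRHS]big_seq.
  apply: ler_sum => x /Hxs hx; rewrite phiE // /psi mxE !cabsM !cabs_emb.
  rewrite !gtr0_norm ?invr_gt0 // /c; move: (cabs _) => t.
  rewrite le_eqVlt; apply/orP; left; apply/eqP; field.
  by rewrite !gt_eqF.
Qed.

(** * Polynomials on the cube *)

Lemma multilinear_diagZ (K : numFieldType) (E F : lmodType K) (k : nat)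
    (A : ('I_k -> E) -> F) (c : K) (u : E) : multilinear A ->
  A (fun=> c *: u) = c ^+ k *: A (fun=> u).
Proof.
move=> Am.
suff H n : (n <= k)%N ->
    A (fun m => if (m < n)%N then c *: u else u) = c ^+ n *: A (fun=> u).
  rewrite -H //; congr A; apply/funext => m; by rewrite ltn_ord.
elim: n => [_|n IH nk]; first by rewrite expr0 scale1r.
have := GRing.scalable_linear (Am (fun m => if (m < n)%N then c *: u else u) (Ordinal nk)) c u.
have e t : (fun j => if j == Ordinal nk then t else if (j < n)%N then c *: u else u) =
    (fun j : 'I_k => if (j < n)%N then c *: u else if (j == n :> nat)%N then t else u).
  apply/funext => j; rewrite -[j == Ordinal nk]/(j == n :> nat).
  by case: eqP => // ->; rewrite ltnn.
rewrite !e => h.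
transitivity (c *: A (fun m => if (m < n)%N then c *: u else u)); last first.
  by rewrite (IH (ltnW nk)) scalerA -exprS.
transitivity (A (fun j : 'I_k => if (j < n)%N then c *: u else if (j == n :> nat)%N then c *: u else u)).
  congr A; apply/funext => j; rewrite ltnS leq_eqVlt.
  by case: eqP => [->|] //=; rewrite ltnn.
rewrite h; congr (_ *: A _); apply/funext => j; case: ifP => // _.
by case: ifP.
Qed.

Lemma homogeneous_scale (K : numFieldType) (E F : lmodType K) (k : nat)
    (P : E -> F) (c : K) (u : E) : homogeneous_polynomial k P ->
  P (c *: u) = c ^+ k *: P u.
Proof. by case=> A Am PA; rewrite !PA multilinear_diagZ. Qed.

(** k^k / k! is at most the binomial coefficient of 2k over k. *)
Lemma expnn_le (k : nat) : (k ^ k <= 4 ^ k * k`!)%N.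
Proof.
suff H : (k ^ k <= (k + k) ^_ k)%N.
  apply: (leq_trans H); rewrite -bin_ffact leq_mul2r; apply/orP; right.
  rewrite (_ : 4 ^ k = 2 ^ (k + k))%N; last by rewrite addnn -mul2n expnM.
  rewrite -[2%N]/(1 + 1)%N expnDn.
  have kk : (k < (k + k).+1)%N by rewrite ltnS leq_addr.
  rewrite (bigD1 (Ordinal kk)) //= !exp1n !muln1; exact: leq_addr.
suff H n m : (n <= m)%N -> (n ^ k <= (m + k) ^_ k)%N by apply: H.
elim: k => [|j IH] nm; first by rewrite expn0.
rewrite addnS ffactnS /= expnS leq_mul ?IH //.
by apply: (leq_trans nm); rewrite -addnS leq_addr.
Qed.

Section PolynomialSumming.
Variables (R : realType) (s : scalar_kind) (q C kappa : R).
Notation K := (scalar_field R s).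
Variables (X F : normedModType K) (k : nat) (P : X -> F) (rho B c : R).
Variables (d : nat) (w : 'rV[K]_d -> X) (zs : seq 'rV[K]_d).
Hypotheses (q1 : 1 <= q) (rho0 : 0 < rho) (c0 : 0 < c) (B0 : 0 <= B) (k0 : (0 < k)%N)
  (kappa0 : 0 <= kappa).
Hypotheses (Phom : homogeneous_polynomial k P)
  (Pb : forall x, rnorm x <= rho -> rnorm (P x) <= B)
  (cF : rcotype C (fun x : F => rnorm x `^ q)).
Hypothesis kappaP : summing_on_cube s q C d kappa.
Hypotheses (wlin : linear w) (wc : forall z, in_cube z -> rnorm (w z) <= c)
  (hzs : weakly_le 2 1 zs).

(** Homogeneity transports the bound from the ball of radius rho to that of
    radius T. *)
Lemma polynomial_bound T x : 0 < T -> rnorm x <= T -> rnorm (P x) <= (T / rho) ^+ k * B.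
Proof.
move=> T0 xT; have t0 : 0 < T / rho by rewrite divr_gt0.
have -> : x = emb s (T / rho) *: (emb s (T / rho)^-1 *: x).
  by rewrite scalerA -embM divff ?gt_eqF // emb1 scale1r.
rewrite (homogeneous_scale _ _ Phom) -rmorphXn /= rnormZ cabs_emb.
rewrite ger0_norm ?exprn_ge0 ?(ltW t0) // ler_wpM2l ?exprn_ge0 ?(ltW t0) //.
apply: Pb; rewrite rnormZ cabs_emb gtr0_norm ?invr_gt0 //.
rewrite ler_pdivrMl // divfK ?gt_eqF //.
Qed.

(** The symmetrization of A is k-linear with diagonal k! P, and polarization bounds
    it on the cube by the values of P at points of norm at most k c. The
    quotient k^k / k! is absorbed by 4^k. *)
Lemma polynomial_summing :
  \sum_(z <- zs) rnorm (P (w z)) `^ q <= kappa ^+ k * ((4 * c / rho) ^+ k * B) `^ q.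
Proof.
have [A Am PA] := Phom.
pose S := symmetrized A.
have Sm : multilinear S := symmetrized_multilinear Am.
pose Bl (r : seq 'rV[K]_d) := S (fun i : 'I_k => w (nth 0 r i)).
have Bslot : slot_linear k Bl.
  move=> r1 r2 e t u v; rewrite /Bl.
  have r1k : (size r1 < k)%N by rewrite -e ltnS leq_addr.
  have H y : (fun i : 'I_k => w (nth 0 (r1 ++ y :: r2) i)) =
     (fun j => if j == Ordinal r1k then w y else w (nth 0 (r1 ++ 0 :: r2) j)).
    apply/funext => j; rewrite -[j == Ordinal r1k]/(j == size r1 :> nat).
    case: eqP => [->|jn]; rewrite !nth_cat ?ltnn ?subnn //.
    case: ltnP => // jr; rewrite -(subnSK (m := size r1) (n := j)) //.
    by rewrite ltn_neqAle jr andbT; apply/eqP => ?; apply: jn.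
  by rewrite !H wlin Sm.
pose M := ((k%:R * c / rho) ^+ k * B) `^ q.
have kR0 : 0 < k%:R :> R by rewrite ltr0n.
have Bb r : size r = k -> (forall x, x \in r -> in_cube x) -> rnorm (Bl r) `^ q <= M.
  move=> szr rc; apply: (ge0_ler_powR (le_trans ler01 q1)); rewrite ?nnegrE ?rnorm_ge0 //.
    by rewrite mulr_ge0 ?exprn_ge0 ?divr_ge0 ?mulr_ge0 ?ler0n ?(ltW c0) ?(ltW rho0).
  rewrite -(@ler_pM2l _ (2 ^+ k)) ?exprn_gt0 //.
  have -> : 2 ^+ k * rnorm (Bl r) = rnorm (2 ^+ k *: Bl r).
    rewrite rnormZ (_ : 2 ^+ k = emb s (2 ^+ k)); last by rewrite rmorphXn /= rmorph_nat.
    by rewrite cabs_emb ger0_norm ?exprn_ge0.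
  rewrite polarization //; apply: (le_trans (rnorm_sum _ _ _)).
  have sgn1 (e : {ffun 'I_k -> bool}) i : cabs (sgn K e i : K) = 1.
    apply: (@emb_inj R s); rewrite emb_cabs emb1 /sgn; case: (e i) => /=.
      by rewrite expr1 normrN1.
    by rewrite expr0 normr1.
  have le (e : {ffun 'I_k -> bool}) : true -> rnorm ((\prod_i sgn K e i) *: 
        A (fun=> \sum_i sgn K e i *: w (nth 0 r i))) <= (k%:R * c / rho) ^+ k * B.
    move=> _; rewrite rnormZ.
    have -> : cabs (\prod_i sgn K e i : K) = 1.
      elim/big_rec: _ => [|i y _ hy]; first by rewrite -(emb1 R s) cabs_emb normr1.
      by rewrite cabsM hy sgn1 mulr1.
    rewrite mul1r -PA; apply: polynomial_bound; first by rewrite mulr_gt0.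
    apply: (le_trans (rnorm_sum _ _ _)).
    apply: (@le_trans _ _ (\sum_(i < k) c)); last by rewrite sumr_const card_ord -[leLHS]mulr_natl.
    apply: ler_sum => i _; rewrite rnormZ sgn1 mul1r; apply: wc; apply: rc.
    by rewrite mem_nth // szr.
  apply: (le_trans (ler_sum _ le)).
  by rewrite sumr_const card_ffun card_bool card_ord -[leLHS]mulr_natl natrX.
have := multilinear_summing q1 Bslot cF Bb kappaP hzs k0.
have diag z : Bl (nseq k z) = P (w z) *+ k`!.
  rewrite PA /Bl -symmetrized_diag; congr S; apply/funext => i.
  by rewrite nth_nseq ltn_ord.
have f0 : 0 < k`!%:R :> R by rewrite ltr0n fact_gt0.
under eq_bigr => z _.
  rewrite diag -scaler_nat -(rmorph_nat (@emb R s)) rnormZ cabs_emb ger0_norm ?ltW //.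
  rewrite powRM ?rnorm_ge0 ?ltW //.
  over.
rewrite -mulr_sumr => h.
have fq0 : 0 < k`!%:R `^ q :> R by rewrite powR_gt0.
rewrite -(ler_pM2l fq0); apply: (le_trans h).
rewrite mulrCA; apply: ler_wpM2l; first exact: exprn_ge0.
rewrite -powRM ?(ltW f0) //; last first.
  by rewrite mulr_ge0 ?exprn_ge0 ?divr_ge0 ?mulr_ge0 ?(ltW c0) ?(ltW rho0).
apply: (ge0_ler_powR (le_trans ler01 q1)); rewrite ?nnegrE.
- by rewrite mulr_ge0 ?exprn_ge0 ?divr_ge0 ?mulr_ge0 ?ler0n ?(ltW c0) ?(ltW rho0).
- by rewrite !mulr_ge0 ?exprn_ge0 ?divr_ge0 ?mulr_ge0 ?ler0n ?(ltW c0) ?(ltW rho0).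
rewrite [leRHS]mulrA; apply: (ler_wpM2r B0).
rewrite -!mulrA !(exprMn _ _ (c / rho)) mulrA; apply: ler_wpM2r.
  by rewrite exprn_ge0 // divr_ge0 // ltW.
by rewrite -!natrX -natrM ler_nat mulnC expnn_le.
Qed.
End PolynomialSumming.

(** * Bounds for the terms of a power series *)

(** There is a single map from the empty type 'I_0. *)
Lemma homogeneous0 (K : numFieldType) (E F : lmodType K) (P : E -> F) (x : E) :
  homogeneous_polynomial 0 P -> P x = P 0.
Proof. by case=> A _ PA; rewrite !PA; congr A; apply/funext => -[]. Qed.

Lemma homogeneousS (K : numFieldType) (E F : lmodType K) (k : nat) (P : E -> F) :
  homogeneous_polynomial k.+1 P -> P 0 = 0.
Proof.
by move=> hP; rewrite -(scale0r (0 : E)) (homogeneous_scale _ _ hP) expr0n scale0r.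
Qed.

Section Analytic.
Variables (R : realType) (s : scalar_kind).
Notation K := (scalar_field R s).
Variables (E F : normedModType K).
Local Open Scope classical_set_scope.

Lemma near0_rnorm (Q : E -> Prop) : (\forall x \near (0 : E), Q x) ->
  exists2 r : R, 0 < r & forall x, rnorm x <= r -> Q x.
Proof.
move=> /nbhs_norm0P [e /= e0 he].
have eE : emb s (scalar_re e) = e by rewrite emb_scalar_re // ltW.
have r0 : 0 < scalar_re e by rewrite -(ltr_emb s) eE emb0.
exists (scalar_re e / 2); first by rewrite divr_gt0.
move=> x xr; apply: he => /=; rewrite -emb_rnorm -eE ltr_emb.
by apply: (le_lt_trans xr); rewrite ltr_pdivrMr // ltr_pMr // ltr1n.
Qed.

Lemma continuous0_bounded (P : E -> F) : continuous P ->
  exists r B : R, [/\ 0 < r, 0 <= B & forall x, rnorm x <= r -> rnorm (P x) <= B].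
Proof.
move=> cP; have /cvgrPdist_le/(_ 1 ltr01)/near0_rnorm[r r0 hr] := cP 0.
exists r, (1 + rnorm (P 0)); split=> //; first by rewrite addr_ge0 ?rnorm_ge0.
move=> x /hr h; have -> : P x = - (P 0 - P x) + P 0 by rewrite opprB subrK.
apply: (le_trans (rnormD _ _)); rewrite lerD2r rnormN.
by rewrite -(ler_emb s) emb_rnorm emb1.
Qed.

Lemma uniform_rnorm (A : set E) (u : nat -> E -> F) (f : E -> F) (e : R) :
  0 < e -> {uniform A, u @ \oo --> f} ->
  exists N, forall n, (N <= n)%N -> forall x, A x -> rnorm (f x - u n x) <= e.
Proof.
move=> e0 hu; have e0' : 0 < emb s e by rewrite -(emb0 R s) ltr_emb.
have : (u @ \oo) [set h | forall y, A y -> ball (f y) (emb s e) (h y)].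
  apply: hu; apply/uniform_nbhs; exists [set xy | ball xy.1 (emb s e) xy.2].
  by split=> //; rewrite -entourage_ballE; exists (emb s e).
move=> [N _ hN]; exists N => n Nn x Ax.
have := hN n Nn x Ax; rewrite -ball_normE /= -emb_rnorm ltr_emb; exact: ltW.
Qed.

(** The partial sums are within 1 of f for n >= N, so P_k is at most 2 for k >= N;
    the finitely many other terms are bounded near 0 by continuity. The constant
    term drops out because f a = P_0. *)
Lemma analytic_at_series (f : E -> F) (a : E) : analytic_at f a ->
  exists (rho B : R) (P : nat -> E -> F),
  [/\ 0 < rho, 0 <= B, forall k, homogeneous_polynomial k (P k),
      forall k x, rnorm x <= rho -> rnorm (P k x) <= B &
      forall e, 0 < e -> exists n, forall x, rnorm x <= rho ->
        rnorm (f (a + x) - f a - \sum_(i < n) P i.+1 x) <= e].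
Proof.
move=> [delta [P [d0 hP hu]]].
have [hom cont] : (forall k, homogeneous_polynomial k (P k)) /\ (forall k, continuous (P k)).
  by split=> k; case: (hP k).
pose d := scalar_re delta; have dE : emb s d = delta by rewrite emb_scalar_re // ltW.
have dpos : 0 < d by rewrite -(ltr_emb s) dE emb0.
have unif e : 0 < e -> exists N, forall n, (N <= n)%N -> forall x, rnorm x <= d / 2 ->
    rnorm (f (a + x) - \sum_(k < n) P k x) <= e.
  move=> e0; have [N hN] := uniform_rnorm e0 hu; exists N => n Nn x xd.
  have := hN n Nn (a + x); rewrite big_mkord addrAC subrr add0r; apply.
  rewrite -ball_normE /= opprD addrA subrr add0r normrN -emb_rnorm -dE ltr_emb.
  by apply: (le_lt_trans xd); rewrite ltr_pdivrMr // ltr_pMr // ltr1n.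
have [N hN] := unif 1 ltr01.
have [r [B [r0 B0 hB]]] : exists r B : R, [/\ 0 < r, 0 <= B &
    forall k, (k < N)%N -> forall x, rnorm x <= r -> rnorm (P k x) <= B].
  elim: (N) => [|n [r [B [r0 B0 hB]]]]; first by exists 1, 0.
  have [r' [B' [r'0 B'0 hB']]] := continuous0_bounded (cont n).
  exists (Num.min r r'), (Num.max B B'); split.
  - by rewrite lt_min r0.
  - by rewrite le_max B0.
  - move=> k; rewrite ltnS leq_eqVlt => /orP[/eqP->|kn] x.
      by rewrite le_min => /andP[_ /hB']; rewrite le_max => ->; rewrite orbT.
    by rewrite le_min => /andP[/(hB _ kn) + _]; rewrite le_max => ->.
exists (Num.min (d / 2) r), (Num.max 2 B), P; split=> //.
- by rewrite lt_min r0 divr_gt0.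
- by rewrite le_max ler0n.
- move=> k x; rewrite le_min => /andP[xd xr]; rewrite le_max.
  have [kN|Nk] := ltnP k N; first by rewrite (hB k) ?orbT.
  apply/orP; left.
  have -> : P k x = (f (a + x) - \sum_(i < k) P i x) - (f (a + x) - \sum_(i < k.+1) P i x).
    rewrite big_ord_recr /=; move: (f (a + x)) (\sum_(i < k) _) (P k x) => u v p.
    by rewrite opprB !addrA subrK addrAC subrr add0r.
  apply: (le_trans (rnormB _ _)); rewrite (_ : 2 = 1 + 1) // lerD // hN //.
  by rewrite ltnW.
- move=> e e0; have e2 : 0 < e / 2 by rewrite divr_gt0.
  have [n hn] := unif _ e2; exists n => x; rewrite le_min => /andP[xd _].
  have nn : (n <= n.+1)%N by [].
  have h1 := hn _ nn x xd.
  have h2 : rnorm (f a - P 0%N 0) <= e / 2.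
    have := hn _ nn 0; rewrite addr0 rnorm0 big_ord_recl /= big1 ?addr0.
      by apply; rewrite divr_ge0 ?ltW.
    by move=> i _; rewrite (homogeneousS (hom _)).
  have -> : f (a + x) - f a - \sum_(i < n) P i.+1 x =
     (f (a + x) - \sum_(k < n.+1) P k x) - (f a - P 0%N 0).
    rewrite big_ord_recl /= (homogeneous0 x (hom 0%N)).
    move: (f (a + x)) (f a) (P 0%N 0) (\sum_(i < n) _) => u v p t.
    by rewrite opprD opprB !addrA [X in _ = X - _]addrAC subrK addrAC.
  by apply: (le_trans (rnormB _ _)); rewrite [leRHS](splitr e) lerD.
Qed.
End Analytic.

(** * Tails of weakly summable sequences *)

(** Convexity with the weights 1/2, 1/4, 1/8, ..., the first term being split off at
    each step. *)
Lemma powR_sum_le (R : realType) (q : R) (n : nat) (b : nat -> R) : 1 <= q ->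
  (forall i, 0 <= b i) ->
  (\sum_(i < n) b i) `^ q <= \sum_(i < n) 2 ^- i.+1 * (2 ^+ i.+1 * b i) `^ q.
Proof.
move=> q1; elim: n b => [|n IH] b b0.
  by rewrite !big_ord0 powR0 // gt_eqF // (lt_le_trans ltr01).
rewrite big_ord_recl [leRHS]big_ord_recl /=.
pose b' i := 2 * b i.+1; have b'0 i : 0 <= b' i by rewrite mulr_ge0.
have := IH b' b'0.
set S := \sum_(i < n) b' i; set T := \sum_(i < n) _ * _ => hST.
have S0 : 0 <= S by rewrite sumr_ge0.
have -> : \sum_(i < n) b (bump 0 i) = (1 - 2^-1) * S.
  rewrite mulr_sumr; apply: eq_bigr => i _; rewrite /b' /bump /= add1n.
  by field.
have -> : b 0%N = 2^-1 * (2 * b 0%N) by rewrite mulrA mulVf ?mul1r.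
apply: (le_trans (powR_convex q1 _ _ S0)).
- by rewrite invr_ge0 ler0n /= invf_le1 ?ltr0n // ler1n.
- by rewrite mulr_ge0.
rewrite !expr1 mulrA divff ?mul1r // lerD2l.
apply: (le_trans (ler_wpM2l _ hST)); first by lra.
rewrite mulr_sumr; apply: ler_sum => i _; rewrite /bump /= add1n /b'.
rewrite (mulrA (2 ^+ i.+1)) -exprSr mulrA le_eqVlt; apply/orP; left; apply/eqP.
congr (_ * _); rewrite (exprS 2 i.+1); field.
by rewrite ?expf_neq0 ?pnatr_eq0.
Qed.

Lemma geometric_sum_le1 (R : realType) n : \sum_(i < n) 2 ^- i.+1 <= 1 :> R.
Proof.
suff -> : \sum_(i < n) 2 ^- i.+1 = 1 - 2 ^- n :> R by rewrite gerBl invr_ge0 exprn_ge0.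
elim: n => [|n IH]; first by rewrite big_ord0 expr0 invr1 subrr.
rewrite big_ord_recr /= IH exprS; field.
by rewrite expf_neq0.
Qed.

(** Here the convergence to 0 of the weak norms of the tails enters. The partial
    sums run over lists, the form that the factorization takes. *)
Lemma lu_seq_tail (R : realType) (s : scalar_kind)
    (X : normedModType (scalar_field R s)) (x : nat -> X) (eta : R) :
  0 < eta -> lu_seq 2 x -> exists m, forall (J : nat)
    (phi : {linear X -> (scalar_field R s)^o}), continuous phi ->
    (opnorm [set: X]%classic phi <= 1%:E)%E ->
    \sum_(y <- [seq x (m + j)%N | j <- iota 0 J]) cabs (phi y) ^+ 2 <= eta ^+ 2.
Proof.
move=> eta0 [_ cv].
have [m _ /(_ m (leqnn m)) hm] : \forall m \near \oo%classic,
    (weak_norm 2 (fun j => x (m + j)%N) < eta%:E)%E.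
  apply: (cv [set y | (y < eta%:E)%E]%classic).
  by apply: open_nbhs_nbhs; split; [exact: open_ereal_lt_ereal|rewrite /= lte_fin].
exists m => J phi cphi ophi.
pose t j : \bar R := ((rnorm (phi (x (m + j)%N))) `^ 2)%:E.
have t0 j : (0 <= t j)%E by rewrite lee_fin powR_ge0.
have hS : ((\sum_(0 <= j <oo) t j) `^ 2^-1 < eta%:E)%E.
  by apply: le_lt_trans hm; apply: ereal_sup_ubound; exists phi.
have hJ : (\sum_(0 <= j < J) t j <= \sum_(0 <= j <oo) t j)%E.
  by apply: nneseries_lim_ge => j _ _.
have S0 : (0 <= \sum_(0 <= j <oo) t j)%E by apply: nneseries_ge0.
rewrite big_map.
have eJ : (\sum_(0 <= j < J) t j = (\sum_(j <- iota 0 J) cabs (phi (x (m + j)%N)) ^+ 2)%:E)%E.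
  rewrite sumEFin /index_iota subn0; congr (_%:E); apply: eq_bigr => j _.
  by rewrite powR_mulrn // rnorm_ge0.
rewrite -lee_fin -eJ; apply: (le_trans hJ).
move: (\sum_(0 <= j <oo) t j)%E S0 hS => [r||] //; last first.
  by rewrite poweRyr ?invr_eq0 ?pnatr_eq0.
rewrite !lee_fin => r0; rewrite poweR_EFin lte_fin powR12_sqrt // => h.
rewrite -(sqr_sqrtr r0) ler_pXn2r ?nnegrE ?sqrtr_ge0 ?(ltW eta0) //; exact: ltW.
Qed.

Lemma nneseries_tail_lty (R : realType) (u : nat -> R) (m : nat) (T : R) :
  (forall j, 0 <= u j) -> (forall J, \sum_(j <- iota 0 J) u (m + j)%N <= T) ->
  (\sum_(0 <= j <oo) (u j)%:E < +oo)%E.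
Proof.
move=> u0 hT; apply: (@le_lt_trans _ _ (\sum_(0 <= j < m) u j + T)%:E); last exact: ltry.
have cv : cvgn (fun n => \sum_(0 <= j < n) (u j)%:E)%E.
  by apply: is_cvg_nneseries => j _ _; rewrite lee_fin.
apply: lime_le => //; apply: nearW => n.
rewrite sumEFin lee_fin; apply: (@le_trans _ _ (\sum_(0 <= j < m + n) u j)).
  rewrite (big_cat_nat (leq0n n) (leq_addl m n)) //= lerDl sumr_ge0 //.
rewrite (big_cat_nat (leq0n m) (leq_addr n m)) //= lerD2l.
rewrite -{1}[m]add0n big_addn addKn /index_iota subn0.
by rewrite (eq_bigr (fun j => u (m + j)%N)) // => j _; rewrite addnC.
Qed.

(** * Summing the power series *)

(** In particular the vectors themselves have norm at most c, each z_j being in the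
    cube. *)
Lemma Linfty_factor_radius (R : realType) (s : scalar_kind)
    (X : normedModType (scalar_field R s)) (lambda c : R) (xs : seq X) :
  0 < lambda -> 0 < c -> Linfty_space X lambda ->
  (forall phi : {linear X -> (scalar_field R s)^o}, continuous phi ->
    (opnorm [set: X]%classic phi <= 1%:E)%E ->
    \sum_(x <- xs) cabs (phi x) ^+ 2 <= (c / lambda) ^+ 2) ->
  exists (d : nat) (w : 'rV[scalar_field R s]_d -> X) (zs : seq 'rV[scalar_field R s]_d),
    [/\ linear w, xs = [seq w z | z <- zs],
        forall z, in_cube z -> rnorm (w z) <= c,
        weakly_le 2 1 zs & forall x, x \in xs -> rnorm x <= c].
Proof.
move=> l0 c0 hX hw.
have [d [w [zs [wl e wc hz]]]] := Linfty_factor l0 (divr_gt0 c0 l0) hX hw.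
have wc' z : in_cube z -> rnorm (w z) <= c.
  by move=> /wc; rewrite mulrC divfK ?gt_eqF.
exists d, w, zs; split=> // x; rewrite e => /mapP[z zz ->]; apply: wc'.
exact: weakly_le_cube hz zz.
Qed.

(** With c = rho / (8 (kappa + 1)) the constant 4 c / rho of [polynomial_summing] is
    1 / (2 (kappa + 1)): its k-th power absorbs kappa^k and the factor 2^k
    that the weighted convexity of t^q puts on the k-th term. *)
Lemma power_series_summing (R : realType) (s : scalar_kind)
    (X F : normedModType (scalar_field R s)) (q C kappa lambda rho B : R)
    (P : nat -> X -> F) (xs : seq X) :
  1 <= q -> 0 < lambda -> 0 <= kappa -> 0 < rho -> 0 <= B ->
  rcotype C (fun x : F => rnorm x `^ q) ->
  (forall d, summing_on_cube s q C d kappa) ->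
  (forall k, homogeneous_polynomial k (P k)) ->
  (forall k x, rnorm x <= rho -> rnorm (P k x) <= B) ->
  Linfty_space X lambda ->
  (forall phi : {linear X -> (scalar_field R s)^o}, continuous phi ->
    (opnorm [set: X]%classic phi <= 1%:E)%E ->
    \sum_(x <- xs) cabs (phi x) ^+ 2 <= (rho / (8 * (kappa + 1)) / lambda) ^+ 2) ->
  (forall x, x \in xs -> rnorm x <= rho) /\
  forall n, \sum_(x <- xs) rnorm (\sum_(i < n) P i.+1 x) `^ q <= B `^ q.
Proof.
move=> q1 l0 k0 r0 B0 cF hk hom hP hX hw.
have q0 : 0 <= q by lra.
have K0 : 0 < 8 * (kappa + 1) by lra.
set c := rho / (8 * (kappa + 1)) in hw.
have c0 : 0 < c by rewrite divr_gt0.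
have crho : c <= rho by rewrite ler_pdivrMr // ler_peMr ?(ltW r0) //; lra.
have [d [w [zs [wl e wc hz xc]]]] := Linfty_factor_radius l0 c0 hX hw.
split=> [x /xc h|n]; first exact: le_trans crho.
have term k : (0 < k)%N -> \sum_(x <- xs) (2 ^+ k * rnorm (P k x)) `^ q <= B `^ q.
  move=> kp.
  have := polynomial_summing q1 r0 c0 B0 kp k0 (hom k) (hP k) cF (hk d) wl wc hz.
  have -> : \sum_(z <- zs) rnorm (P k (w z)) `^ q = \sum_(x <- xs) rnorm (P k x) `^ q.
    by rewrite e big_map.
  move=> h.
  have -> : \sum_(x <- xs) (2 ^+ k * rnorm (P k x)) `^ q =
     (2 ^+ k) `^ q * \sum_(x <- xs) rnorm (P k x) `^ q.
    rewrite mulr_sumr; apply: eq_bigr => x _.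
    by rewrite powRM ?rnorm_ge0 ?exprn_ge0.
  apply: (le_trans (ler_wpM2l (powR_ge0 _ _) h)).
  have e1 : 4 * c / rho = (2 * (kappa + 1))^-1.
    by rewrite /c; field; rewrite !gt_eqF //; lra.
  rewrite e1.
  have k1 : 1 <= kappa + 1 by lra.
  set t := kappa + 1 in k1 *.
  have t0 : 0 < t by lra.
  have i0 : 0 <= (2 * t)^-1 by rewrite invr_ge0; lra.
  rewrite mulrCA -powRM ?mulr_ge0 ?exprn_ge0 //.
  have -> : 2 ^+ k * ((2 * t)^-1 ^+ k * B) = (t ^+ k)^-1 * B.
    rewrite mulrA -exprMn -exprVn; congr (_ ^+ k * _); field.
    by rewrite gt_eqF.
  rewrite powRM ?invr_ge0 ?exprn_ge0 ?(ltW t0) // mulrA ler_piMl ?powR_ge0 //.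
  have tk : 0 < t ^+ k by rewrite exprn_gt0.
  have -> : (t ^+ k)^-1 `^ q = ((t ^+ k) `^ q)^-1.
    by rewrite -powR_inv1 ?(ltW tk) // powRAC powR_inv1 ?powR_ge0.
  rewrite ler_pdivrMr ?powR_gt0 // mul1r.
  apply: (@le_trans _ _ (t ^+ k)).
    by rewrite ler_pXn2r ?nnegrE ?(ltW t0) // /t lerDl.
  by apply: le1r_powR => //; rewrite exprn_ege1.
apply: (@le_trans _ _ (\sum_(x <- xs) \sum_(i < n) 2 ^- i.+1 * (2 ^+ i.+1 * rnorm (P i.+1 x)) `^ q)).
  apply: ler_sum => x _.
  apply: le_trans (powR_sum_le n (b := fun i => rnorm (P i.+1 x)) q1 _); last first.
    by move=> i; apply: rnorm_ge0.
  apply: ge0_ler_powR; rewrite ?nnegrE ?rnorm_ge0 ?rnorm_sum //.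
  by rewrite sumr_ge0 // => i _; apply: rnorm_ge0.
rewrite exchange_big /=.
apply: (@le_trans _ _ (\sum_(i < n) 2 ^- i.+1 * B `^ q)).
  apply: ler_sum => i _; rewrite -mulr_sumr ler_wpM2l ?invr_ge0 ?exprn_ge0 //.
  exact: term.
by rewrite -mulr_suml ler_piMl ?powR_ge0 // geometric_sum_le1.
Qed.

(** For the first J vectors of the tail, f is replaced by a partial sum of its series
    with error at most 1 / (J + 1) at each of them; the errors then add up to at
    most 1, whatever J is. *)
Lemma analytic_summing_real (R : realType) (s : scalar_kind)
    (X F : normedModType (scalar_field R s)) (q lambda : R) (f : X -> F) (a : X) :
  2 <= q -> has_cotype F q%:E -> 1 < lambda -> Linfty_space X lambda ->
  analytic_at f a -> absolutely_summing_at q%:E 2 f a.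
Proof.
move=> q2 hF hl hX /analytic_at_series[rho [B [P [r0 B0 hom hP happ]]]] x hx.
have q1 : 1 <= q by lra.
have l0 : 0 < lambda by lra.
have [C C0 cF] := rcotype_of_cotype q2 hF.
have [kappa k0 hk] := linear_summing s q2 C0.
have eta0 : 0 < rho / (8 * (kappa + 1)) / lambda.
  by rewrite !divr_gt0 //; lra.
have [m hm] := lu_seq_tail eta0 hx.
pose D y := f (a + y) - f a.
apply: (@nneseries_tail_lty _ (fun j => rnorm (D (x j)) `^ q) m
         (2 `^ q / 2 * (B `^ q + 1))).
  by move=> j; apply: powR_ge0.
move=> J.
pose xs := [seq x (m + j)%N | j <- iota 0 J].
have [xrho hsum] := power_series_summing q1 l0 k0 r0 B0 cF hk hom hP hX (hm J).
rewrite -(big_map (fun j => x (m + j)%N) xpredT (fun y => rnorm (D y) `^ q)) -/xs.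
have J0 : 0 < J.+1%:R :> R by rewrite ltr0n.
have e0 : 0 < J.+1%:R^-1 :> R by rewrite invr_gt0.
have [n hn] := happ _ e0.
pose Sn y := \sum_(i < n) P i.+1 y.
have le y : y \in xs -> rnorm (D y) `^ q <= 2 `^ q / 2 * (rnorm (Sn y) `^ q + J.+1%:R^-1).
  move=> /xrho hy; have -> : D y = Sn y + (D y - Sn y) by rewrite addrC subrK.
  apply: (le_trans (qconvex_add (qconvex_rnorm F q1) _ _)).
  rewrite ler_wpM2l ?divr_ge0 ?powR_ge0 // lerD2l.
  apply: (@le_trans _ _ (J.+1%:R^-1 `^ q)).
    apply: ge0_ler_powR; rewrite ?nnegrE ?rnorm_ge0 ?(ltW e0) //; first by lra.
    exact: hn.
  by apply: ge1r_powR => //; rewrite e0 invf_le1 // ler1n.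
rewrite big_seq; apply: (le_trans (ler_sum _ le)); rewrite -big_seq.
rewrite -mulr_sumr ler_wpM2l ?divr_ge0 ?powR_ge0 // big_split /= lerD //.
  exact: hsum.
rewrite big_const_seq count_predT iter_addr_0 size_map size_iota -[leLHS]mulr_natr.
by rewrite ler_pdivrMl // mulr1 ler_nat.
Qed.

(** The tail lies in the ball on which f is within 1 of a partial sum, and this
    partial sum is bounded there. *)
Lemma analytic_summing_infty (R : realType) (s : scalar_kind)
    (X F : normedModType (scalar_field R s)) (lambda : R) (f : X -> F) (a : X) :
  1 < lambda -> Linfty_space X lambda ->
  analytic_at f a -> absolutely_summing_at +oo%E 2 f a.
Proof.
move=> hl hX /analytic_at_series[rho [B [P [r0 B0 hom hP happ]]]] x hx.
have l0 : 0 < lambda by lra.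
have [m hm] := lu_seq_tail (divr_gt0 r0 l0) hx.
have [n hn] := happ _ ltr01.
pose D y := f (a + y) - f a.
have tail j : rnorm (D (x (m + j)%N)) <= 1 + n%:R * B.
  have [d [w [zs [_ _ _ _ xc]]]] := Linfty_factor_radius l0 r0 hX (hm j.+1).
  have hy : rnorm (x (m + j)%N) <= rho.
    by apply: xc; apply: map_f; rewrite mem_iota add0n ltnSn.
  pose S := \sum_(i < n) P i.+1 (x (m + j)%N).
  have -> : D (x (m + j)%N) = (D (x (m + j)%N) - S) + S by rewrite subrK.
  apply: (le_trans (rnormD _ _)); rewrite lerD ?hn //.
  apply: (le_trans (rnorm_sum _ _ _)).
  apply: (@le_trans _ _ (\sum_(i < n) B)); first by apply: ler_sum => i _; apply: hP.
  by rewrite sumr_const card_ord mulr_natl.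
exists (\sum_(j < m) rnorm (D (x j)) + (1 + n%:R * B)) => j.
have M0 : 0 <= 1 + n%:R * B by rewrite addr_ge0 ?mulr_ge0.
have [jm|mj] := ltnP j m; last first.
  rewrite -(subnKC mj); apply: (le_trans (tail _)); rewrite lerDr sumr_ge0 // => i _.
  exact: rnorm_ge0.
rewrite (bigD1 (Ordinal jm)) //= -addrA lerDl addr_ge0 // sumr_ge0 // => i _.
exact: rnorm_ge0.
Qed.

Theorem theorem16 (R : realType) (s : scalar_kind)
    (X F : completeNormedModType (scalar_field R s)) (q : \bar R) (lambda : R)
    (f : X -> F) (a : X)
    (hq : (2%:E <= q)%E)
    (hF : has_cotype F q)
    (hlambda : 1 < lambda)
    (hX : Linfty_space X lambda)
    (hf : analytic_at f a) :
  absolutely_summing_at q 2 f a.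
Proof.
case: q hq hF => [q|_ _|//] hq hF.
  by rewrite lee_fin in hq; apply: (analytic_summing_real hq hF hlambda hX hf).
exact: (analytic_summing_infty hlambda hX hf).
Qed.
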